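(* Let $R$ be a finite ring. Then the unitary Cayley graph $\Gamma(R)$ is well-covered if and only if one of the following holds: (1) $R/J(R)$ is isomorphic to $F$, $F\times F$, or $M_2(F)$ for some finite field $F$; (2) $R/J(R)$ is isomorphic to $\mathbb{Z}_2^k$ for some positive integer $k$.
   Context: All rings are finite, associative, with a nonzero identity. $J(R)$ is the Jacobson radical of $R$, and $M_2(F)$ is the ring of $2\times 2$ matrices over $F$. The unitary Cayley graph $\Gamma(R)$ has vertex set $R$, with distinct $x,y$ adjacent iff $x-y$ is a unit of $R$. A graph is well-covered if all its maximal independent sets have the same cardinality. *)

(* Defs.v *)
From HB Require Import structures.
From mathcomp Require Import all_boot all_order all_algebra.

Set Implicit Arguments.
Unset Strict Implicit.
Unset Printing Implicit Defensive.

Import GRing.Theory.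
Local Open Scope ring_scope.

Section Graph.
Variables (T : finType) (e : rel T).

Definition independent (A : {set T}) : bool :=
  [forall x in A, forall y in A, ~~ e x y].

Definition well_covered : Prop :=
  forall A B : {set T},
    maxset independent A -> maxset independent B -> #|A| = #|B|.

End Graph.

(* In a [unitRingType], [GRing.unit] is exactly two-sided invertibility
   (lemma [unitrP]), so it is determined by the ring structure. *)
Definition unitary_cayley (R : finUnitRingType) : rel R :=
  fun x y => (x != y) && (x - y \is a GRing.unit).

Section Jacobson.
Variable R : finNzRingType.

(* Boolean form of the library's [idealr_closed], whose scalars act on the
   left; see [proper_left_idealP]. *)
Definition proper_left_ideal (I : {set R}) : bool :=
  [&& 0 \in I, 1 \notin I
    & [forall a : R, forall u in I, forall v in I, a * u + v \in I]].

Lemma proper_left_idealP (I : {set R}) :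
  reflect (idealr_closed I) (proper_left_ideal I).
Proof.
apply: (iffP and3P) => [[I0 I1 /forallP IH]|[I0 I1 IH]]; split=> //.
  by move=> a u v uI vI; move/forall_inP: (IH a) => /(_ u uI)/forall_inP; apply.
by apply/forallP=> a; apply/forall_inP=> u uI; apply/forall_inP=> v; exact: IH.
Qed.

Definition maximal_left_ideal (M : {set R}) : bool :=
  maxset proper_left_ideal M.

Definition jacobson_set : {set R} :=
  \bigcap_(M : {set R} | maximal_left_ideal M) M.

Definition jacobson : {pred R} := [pred x | x \in jacobson_set].

Lemma jacobsonP x :
  reflect (forall M : {set R}, maximal_left_ideal M -> x \in M)
          (x \in jacobson).
Proof. by rewrite inE; exact: bigcapP. Qed.

Lemma maximal_left_idealW (M : {set R}) :
  maximal_left_ideal M -> idealr_closed M.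
Proof. by move=> /maxsetp/proper_left_idealP. Qed.

Lemma exists_maximal_left_ideal : exists M : {set R}, maximal_left_ideal M.
Proof.
have P0 : proper_left_ideal [set 0].
  apply/proper_left_idealP; split; rewrite ?inE ?oner_eq0 // => a u v.
  by rewrite !inE => /eqP-> /eqP->; rewrite mulr0 addr0.
by have [M maxM _] := maxset_exists P0; exists M.
Qed.

Lemma jacobson_idealr : idealr_closed jacobson.
Proof.
split.
- by apply/jacobsonP=> M /maximal_left_idealW[].
- have [M maxM] := exists_maximal_left_ideal.
  have [_ M1 _] := maximal_left_idealW maxM.
  by apply: contra M1 => /jacobsonP; apply.
- move=> a u v /jacobsonP uJ /jacobsonP vJ; apply/jacobsonP=> M maxM.
  by have [_ _] := maximal_left_idealW maxM; apply; [exact: uJ|exact: vJ].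
Qed.

HB.instance Definition _ := isIdealr.Build R jacobson jacobson_idealr.

(* If [r \notin M] then [(M : r) = {a | a * r \in M}] is again a maximal left
   ideal. *)
Lemma maximal_left_ideal_colon (M : {set R}) r :
  maximal_left_ideal M -> r \notin M ->
  maximal_left_ideal [set a | a * r \in M].
Proof.
move=> maxM rM; have [M0 M1 Mlin] := maximal_left_idealW maxM.
apply/maxsetP; split=> [|I /proper_left_idealP[I0 I1 Ilin] sI].
  apply/proper_left_idealP; split; rewrite ?inE ?mul0r ?mul1r // => a u v.
  by rewrite !inE mulrDl -mulrA; exact: Mlin.
apply/eqP; rewrite eqEsubset sI andbT; apply/subsetP=> b bI.
rewrite inE; apply: contraNT I1 => brM.
pose N := [set x | [exists d : R, x - d * (b * r) \in M]].
have NP x : reflect (exists d : R, x - d * (b * r) \in M) (x \in N).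
  by rewrite inE; exact: existsP.
have sMN : M \subset N.
  by apply/subsetP=> x xM; apply/NP; exists 0; rewrite mul0r subr0.
have brN : b * r \in N by apply/NP; exists 1; rewrite mul1r subrr.
have N1 : 1 \in N.
  apply: contraNT brM => N1; suff <- : N = M by [].
  case/maxsetP: maxM => _; apply=> //; apply/proper_left_idealP; split=> //.
    by exact: (subsetP sMN).
  move=> a u v /NP[d du] /NP[c cv]; apply/NP; exists (a * d + c).
  have -> : a * u + v - (a * d + c) * (b * r)
          = a * (u - d * (b * r)) + (v - c * (b * r)).
    by rewrite mulrBr mulrDl -mulrA opprD addrACA.
  exact: Mlin.
have /NP[d dM] := N1.
have rdI : 1 - r * d * b \in I.
  apply: (subsetP sI); rewrite inE mulrBl mul1r.
  have := Mlin r _ _ dM M0; rewrite addr0 mulrBr mulr1.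
  by rewrite !mulrA.
by have := Ilin (r * d) b _ bI rdI; rewrite addrC subrK.
Qed.

Lemma jacobsonMr x r : x \in jacobson -> x * r \in jacobson.
Proof.
move=> /jacobsonP xJ; apply/jacobsonP=> M maxM.
have [M0 _ Mlin] := maximal_left_idealW maxM.
have [rM|rM] := boolP (r \in M).
  by have := Mlin x _ _ rM M0; rewrite addr0.
by have := xJ _ (maximal_left_ideal_colon maxM rM); rewrite inE.
Qed.

(* The library equips [Quotient.quot] with a ring structure only over
   commutative rings; the quotient of [R] by its (two-sided) Jacobson radical
   is given its ring structure here. *)
Definition jacobson_quot := Quotient.quot jacobson.

HB.instance Definition _ := EqQuotient.on jacobson_quot.
HB.instance Definition _ := GRing.Zmodule.on jacobson_quot.
HB.instance Definition _ :=
  isZmodQuotient.Build R (Quotient.equiv jacobson) 0 -%R +%R jacobson_quot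
    (@pi_zeror _ _ _ _ _ (Quotient.quot jacobson))
    (@pi_oppr _ _ _ _ _ (Quotient.quot jacobson))
    (@pi_addr _ _ _ _ _ (Quotient.quot jacobson)).

Definition jquot_one : jacobson_quot := \pi_jacobson_quot%qT 1.
Definition jquot_mul (x y : jacobson_quot) : jacobson_quot :=
  \pi_jacobson_quot%qT (repr x * repr y).

Lemma jquot_eqP (x y : R) :
  reflect (\pi_jacobson_quot%qT x = \pi_jacobson_quot%qT y)
          (x - y \in jacobson).
Proof.
by rewrite (Quotient.idealrBE jacobson); exact: eqP.
Qed.

Lemma jquot_piM :
  {morph \pi_jacobson_quot%qT : x y / x * y >-> jquot_mul x y}.
Proof.
move=> x y; apply/jquot_eqP.
set x' := repr _; set y' := repr _.
have xx' : x - x' \in jacobson by apply/jquot_eqP; rewrite reprK.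
have yy' : y - y' \in jacobson by apply/jquot_eqP; rewrite reprK.
have -> : x * y - x' * y' = (x - x') * y + x' * (y - y').
  by rewrite mulrBl mulrBr addrA subrK.
apply: rpredD; first exact: jacobsonMr.
exact: idealMr.
Qed.

Lemma jquot_mulA : associative jquot_mul.
Proof.
elim/quotW=> x; elim/quotW=> y; elim/quotW=> z.
by rewrite -(jquot_piM y z) -(jquot_piM x y) -!jquot_piM mulrA.
Qed.

Lemma jquot_mul1q : left_id jquot_one jquot_mul.
Proof. by elim/quotW=> x; rewrite -jquot_piM mul1r. Qed.

Lemma jquot_mulq1 : right_id jquot_one jquot_mul.
Proof. by elim/quotW=> x; rewrite -jquot_piM mulr1. Qed.

Lemma jquot_mulDl : left_distributive jquot_mul +%R.
Proof.
elim/quotW=> x; elim/quotW=> y; elim/quotW=> z.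
by rewrite -pi_addr -(jquot_piM x z) -(jquot_piM y z) -jquot_piM mulrDl pi_addr.
Qed.

Lemma jquot_mulDr : right_distributive jquot_mul +%R.
Proof.
elim/quotW=> x; elim/quotW=> y; elim/quotW=> z.
by rewrite -pi_addr -(jquot_piM x y) -(jquot_piM x z) -jquot_piM mulrDr pi_addr.
Qed.

Lemma jquot_1neq0 : jquot_one != 0.
Proof.
apply/eqP; rewrite -[0]pi_zeror => /jquot_eqP.
by rewrite subr0 idealr1.
Qed.

HB.instance Definition _ := GRing.Zmodule_isNzRing.Build jacobson_quot
  jquot_mulA jquot_mul1q jquot_mulq1 jquot_mulDl jquot_mulDr jquot_1neq0.

HB.instance Definition _ := @isNzRingQuotient.Build
  R (Quotient.equiv jacobson) 0 -%R +%R 1%R *%R jacobson_quot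
  (erefl _) jquot_piM.

End Jacobson.

Definition ring_isomorphic (A B : pzRingType) : Prop :=
  exists f : {rmorphism A -> B}, bijective f.

(* Main.v *)
Require Import Defs.
From HB Require Import structures.
From mathcomp Require Import all_boot all_order all_algebra all_fingroup.
From mathcomp Require Import all_solvable all_field.
From mathcomp Require Import zify ring.

(* Units lift along R -> S = R/J(R), so the question only concerns S. Choose a
   complete set E of orthogonal primitive idempotents of S. For e in E the
   annihilator {x | x e = 0} is a maximal independent set, so well-coveredness
   forces all the |S e| to equal one number q. If E contains three idempotents
   e1, e2, e3, then {x | x (e1 + e2 + e3) has rank at most 1} is also a maximal
   independent set, and comparing its size with that of an annihilator gives
   h12 h13 + h23 = q with hij = |ei S ej|; since the hij other than 1 agree
   whenever they share an index and q is at least the product of the |ei S ek|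
   over i, this forces q = 2, and then S is a power of Z_2. With one or two
   idempotents, S is a finite division ring, a product of two fields of order q,
   or a 2 x 2 matrix ring over e1 S e1.
   Conversely, in F x F and in M_2(F), elements whose pairwise differences are
   singular either all agree in the same "row" or all agree in the same
   "column", which leaves only annihilators as maximal independent sets
   containing 0; over Z_2^k a maximal independent set and its translate by 1
   partition the ring. *)

Set Implicit Arguments.
Unset Strict Implicit.
Unset Printing Implicit Defensive.

Import GRing.Theory.
Local Open Scope ring_scope.

(** * Maximal independent sets and the Jacobson radical *)

(** Left multiplication by [x] is injective, hence bijective on a finite ring, so [x] also has a
    right inverse. *)
Lemma unitr_linv (R : finUnitRingType) (x y : R) : y * x = 1 -> x \is a GRing.unit.
Proof.
move=> yx; have inj : injective (fun r : R => x * r).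
  by move=> r s /(congr1 ( *%R y)); rewrite !mulrA yx !mul1r.
have [g _ gK] := injF_bij inj; have xg := gK 1.
apply/unitrP; exists y; split=> //.
by rewrite -[y]mulr1 -{1}xg [y * _]mulrA yx mul1r.
Qed.

(** Each fibre over a point of [D] is a translate of the kernel. *)
Lemma card_preim_additive (V W : finZmodType) (f : {additive V -> W})
    (D : {set W}) : {in D, forall w, exists v, f v = w} ->
  #|[set x | f x \in D]| = (#|D| * #|[set x | f x == 0%R]|)%N.
Proof.
move=> surj; rewrite -sum1_card (partition_big f (mem D)) /=; last first.
  by move=> x; rewrite inE.
rewrite -sum_nat_const; apply: eq_bigr => w wD; have [v fv] := surj w wD.
rewrite sum1dep_card -[RHS](card_imset _ (addrI v)) //.
apply: eq_card => x; rewrite !inE.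
apply/andP/imsetP => [[_ /eqP fx]|[y]].
  by exists (x - v); rewrite ?inE ?raddfB /= ?fx ?fv ?subrr // addrC subrK.
by rewrite inE => /eqP fy ->; rewrite raddfD /= fy fv addr0.
Qed.

Section UnitaryCayley.
Variable R : finUnitRingType.
Implicit Types A B : {set R}.

Definition nonunit_diff A :=
  forall x y, x \in A -> y \in A -> x - y \isn't a GRing.unit.

Definition unit_dominating A :=
  forall x, x \notin A -> exists2 a, a \in A & x - a \is a GRing.unit.

Lemma independentP A :
  reflect (nonunit_diff A) (independent (@unitary_cayley R) A).
Proof.
apply: (iffP forall_inP) => [indA x y xA yA | indA x xA].
  have /forall_inP/(_ y yA) := indA x xA; rewrite /unitary_cayley.
  by case: eqP => //= ->; rewrite subrr unitr0.
by apply/forall_inP => y yA; rewrite negb_and (indA x y) ?orbT.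
Qed.

Lemma maximal_independentP A :
  reflect (nonunit_diff A /\ unit_dominating A)
          (maxset (independent (@unitary_cayley R)) A).
Proof.
apply: (iffP maxsetP) => [[/independentP indA maxA]|[indA domA]].
  split=> // x xA; apply/exists_inP; apply: contraT => /exists_inPn noA.
  suff eqA : x |: A = A by rewrite -eqA setU11 in xA.
  apply: maxA (subsetUr _ _); apply/independentP => y z.
  have Nu a b : a - b \is a GRing.unit = (b - a \is a GRing.unit).
    by rewrite -unitrN opprB.
  case/setU1P=> [->|yA] /setU1P[->|zA]; rewrite ?subrr ?unitr0 //.
  - exact: noA.
  - by rewrite Nu; exact: noA.
  - exact: indA.
split; first exact/independentP.
move=> B /independentP indB sAB; apply/eqP; rewrite eqEsubset sAB andbT.
apply/subsetP=> x xB; apply: contraT => /domA[a aA].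
by rewrite (negbTE (indB _ _ xB (subsetP sAB _ aA))).
Qed.

(** Translations are automorphisms of the graph, so a maximal independent set may be moved to one
    containing 0; it is nonempty because 0 must be dominated. *)
Lemma well_covered_intro m :
    (forall A, nonunit_diff A -> unit_dominating A -> 0 \in A -> #|A| = m) ->
  well_covered (@unitary_cayley R).
Proof.
move=> cardA; suff hA A : maxset (independent (@unitary_cayley R)) A -> #|A| = m.
  by move=> A B /hA-> /hA->.
case/maximal_independentP => indA domA.
have [a aA|A0] := pickP (mem A); last by have [a] := domA 0 (negbT (A0 0));
  rewrite [a \in A]A0.
rewrite -(card_imset _ (addIr (- a))); apply: cardA.
- move=> _ _ /imsetP[x xA ->] /imsetP[y yA ->].
  by rewrite opprB addrA subrK; exact: indA.
- move=> x xA; have [|b bA ub] := domA (x + a).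
    by apply: contra xA => xaA; apply/imsetP; exists (x + a); rewrite ?addrK.
  exists (b - a); first exact: (imset_f (+%R^~ (- a))).
  by rewrite opprB addrA.
- by apply/imsetP; exists a; rewrite ?subrr.
Qed.

Lemma nonunit_diff_maximal A B :
  unit_dominating A -> nonunit_diff B -> A \subset B -> A = B.
Proof.
move=> domA indB sAB; apply/eqP; rewrite eqEsubset sAB.
apply/subsetP=> x xB; apply: contraT => /domA[a aA].
by rewrite (negbTE (indB _ _ xB (subsetP sAB _ aA))).
Qed.

End UnitaryCayley.

(** * Units modulo the Jacobson radical *)

Section JacobsonUnits.
Variable R : finUnitRingType.

(** Without a left inverse of [x], the left ideal [R x] is proper and lies in a maximal one, which
    then contains [x] and [x - 1], hence 1. *)
Lemma unitr_mod_jacobson (x : R) : x - 1 \in @jacobson R -> x \is a GRing.unit.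
Proof.
move=> xJ; suff /exists_eqP[y /eqP] : [exists y, y * x == 1].
  by move/eqP => yx; apply: unitr_linv yx.
apply: contraT => /existsPn noinv.
have pL : proper_left_ideal [set y * x | y : R].
  apply/proper_left_idealP; split.
  - by apply/imsetP; exists 0; rewrite ?mul0r.
  - by apply/imsetP=> -[y _ /esym/eqP]; rewrite (negbTE (noinv y)).
  - move=> a _ _ /imsetP[u _ ->] /imsetP[v _ ->].
    by apply/imsetP; exists (a * u + v); rewrite // mulrDl mulrA.
have [M maxM sLM] := maxset_exists pL.
have [_ /negP M1 Mlin] := maximal_left_idealW maxM; case: M1.
have xM : x \in M by apply: (subsetP sLM); apply/imsetP; exists 1; rewrite ?mul1r.
have x1M : x - 1 \in M by apply: (jacobsonP _ xJ).
by have := Mlin (-1) _ _ x1M xM; rewrite mulN1r opprB subrK.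
Qed.

(** Units lift modulo the radical. Invertibility in [T] is phrased by a left inverse because [T]
    carries no unit predicate. *)
Lemma jacobson_quot_iso_reflect_unit (T : pzRingType) :
    ring_isomorphic (jacobson_quot R) T ->
  exists f : {rmorphism R -> T}, (forall t, exists r, f r = t) /\
    forall x, x \is a GRing.unit <-> exists y, y * f x = 1.
Proof.
case=> g [h gK hK]; pose p : {rmorphism R -> jacobson_quot R} :=
  \pi_(jacobson_quot R)%qT.
exists (g \o p : {rmorphism R -> T}).
have surj t : exists r, (g \o p) r = t.
  by have := hK t; elim/quotW: (h t) => r <-; exists r.
split=> // x; split=> [ux|[y]].
  by exists ((g \o p) x^-1); rewrite -rmorphM mulVr // rmorph1.
have [r <-] := surj y; rewrite -rmorphM -[1](rmorph1 (g \o p)) /=.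
move=> /(can_inj gK)/jquot_eqP/unitr_mod_jacobson urx.
by apply: (@unitr_linv _ _ ((r * x)^-1 * r)); rewrite -mulrA mulVr.
Qed.

End JacobsonUnits.

(** * The listed rings are well-covered *)

(** If [P a b] fails then [Q a b]; any [c] with [P a c] cannot satisfy [P b c], so it is [Q]-related
    to [b] and hence to [a]. Transitivity is asked only inside [A], since parallelism of matrices is
    not transitive through 0. *)
Lemma all_related_by_one (T : finType) (A : {set T}) (P Q : rel T) :
    symmetric P -> symmetric Q ->
    {in A & &, transitive P} -> {in A & &, transitive Q} ->
    {in A &, forall x y, P x y || Q x y} ->
  {in A &, forall x y, P x y} \/ {in A &, forall x y, Q x y}.
Proof.
move=> symP symQ trP trQ PQ.
have [/forall_inP allP|] := boolP [forall x in A, forall y in A, P x y].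
  by left=> x y xA yA; have /forall_inP/(_ y yA) := allP x xA.
case/forall_inPn=> a aA /forall_inPn[b bA nPab]; right.
have Qab : Q a b by have := PQ _ _ aA bA; rewrite (negbTE nPab).
suff Qa c : c \in A -> Q a c.
  by move=> x y xA yA; apply: (trQ a) => //; rewrite ?Qa // symQ Qa.
move=> cA; have /orP[Pac|//] := PQ _ _ aA cA.
have /orP[Pbc|Qbc] := PQ _ _ bA cA; last exact: (trQ b).
by case/negP: nPab; apply: (trP c) => //; rewrite symP.
Qed.

Lemma card_kernel_additive (V W : finZmodType) (f : {additive V -> W}) :
    (forall w, exists v, f v = w) ->
  (#|W| * #|[set x | f x == 0%R]|)%N = #|V|.
Proof.
move=> surj; rewrite -[#|W|]cardsT -[RHS]cardsT.
rewrite -(@card_preim_additive _ _ f); last by move=> w _; exact: surj.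
by apply: eq_card => x; rewrite !inE.
Qed.

(** * Singular 2 x 2 matrices with singular differences *)

Section Singular2.
Variable F : fieldType.
Implicit Types a b : 'M[F]_2.

Lemma ord2_cases (i : 'I_2) : i = 0 \/ i = 1.
Proof. by case: i => [[|[|m]] // ltm]; [left|right]; apply: val_inj. Qed.

Lemma det2E a : \det a = a 0 0 * a 1 1 - a 0 1 * a 1 0.
Proof.
rewrite (expand_det_row _ 0) !big_ord_recl big_ord0 /cofactor !det_mx11 !mxE /=.
have -> : lift 0 0 = 1 :> 'I_2 by apply: val_inj.
have -> : lift 1 0 = 0 :> 'I_2 by apply: val_inj.
by rewrite expr0 expr1 mul1r addr0 mulN1r mulrN.
Qed.

Lemma singular2_rank1 a : \det a = 0 ->
  exists c r : 'I_2 -> F, forall i j, a i j = c i * r j.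
Proof.
rewrite det2E => /eqP; rewrite subr_eq0 => /eqP deta.
have [k a0k|a0] := pickP (fun k => a 0 k != 0).
  (* With a pivot in row 0, row 1 is a multiple of row 0; without one, row 0 vanishes and row 1
     itself is the row factor. *)
  exists (fun i => a i k / a 0 k), (a 0) => i j.
  have [-> | ->] := ord2_cases i; first by rewrite divff ?mul1r.
  apply: (mulIf a0k); rewrite mulrAC divfK //.
  case: (ord2_cases j) (ord2_cases k) => -> [] ->; first by rewrite mulrC.
  - by rewrite mulrC -deta mulrC.
  - by rewrite mulrC deta mulrC.
  - by rewrite mulrC.
pose c (i : 'I_2) : F := (i == 1)%:R; exists c, (a 1) => i j; rewrite /c.
by case: (ord2_cases i) => ->; rewrite ?mul1r // mul0r; apply/eqP/negbFE/a0.
Qed.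

Lemma nonzero_col a : a != 0 -> exists l, (a 0 l != 0) || (a 1 l != 0).
Proof.
move=> a0; apply/existsP; apply: contraR a0; rewrite negb_exists => /forallP al.
apply/eqP/matrixP => k l; rewrite mxE; have := al l.
rewrite negb_or !negbK => /andP[/eqP a0l /eqP a1l].
by case: (ord2_cases k) => ->.
Qed.

(** Every column of [a] is proportional to every column of [b]: all the mixed 2 x 2 minors vanish.
    Applied to transposes, it compares rows. *)
Definition col_parallel a b :=
  [forall i, forall j, a 0 i * b 1 j == a 1 i * b 0 j].

Lemma col_parallelP a b :
  reflect (forall i j, a 0 i * b 1 j = a 1 i * b 0 j) (col_parallel a b).
Proof. exact: 'forall_'forall_eqP. Qed.

Lemma col_parallel_sym : symmetric col_parallel.
Proof.
move=> a b; apply/col_parallelP/col_parallelP => ab i j.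
  by rewrite mulrC -ab mulrC.
by rewrite mulrC -ab mulrC.
Qed.

Lemma col_parallel_trans b a c :
  b != 0 -> col_parallel a b -> col_parallel b c -> col_parallel a c.
Proof.
move=> b0 /col_parallelP ab /col_parallelP bc; apply/col_parallelP => i j.
have [l bl] := nonzero_col b0.
have := ab i l; have := bc l j.
case/orP: bl => bl bclj abil; apply: (mulIf bl).
  by rewrite -mulrA [c 1 j * _]mulrC bclj mulrA abil mulrAC.
by rewrite mulrAC abil -mulrA bclj mulrAC mulrA.
Qed.

(** For rank-one matrices [a = c r] and [b = c' r'], [\det (a - b)] is, up to sign, the minor of
    [c, c'] times the minor of [r, r']; so one of the two vanishes. *)
Lemma singular2_parallel a b :
  \det a = 0 -> \det b = 0 -> \det (a - b) = 0 ->
  col_parallel a b || col_parallel a^T b^T.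
Proof.
move=> /singular2_rank1[c [r ac]] /singular2_rank1[c' [r' bc]].
rewrite det2E !mxE !ac !bc => det0.
have [//|/forallPn[i /forallPn[j nab]]] := boolP (col_parallel a b).
move: nab; rewrite -subr_eq0 !ac !bc => nab.
apply/col_parallelP=> k l; rewrite !mxE !ac !bc.
(* A nonzero mixed column minor times any mixed row minor is a multiple of [d], which is
   [- \det (a - b)]. *)
apply: (mulfI nab); apply/eqP; rewrite -subr_eq0; apply/eqP.
pose d := (c 0 * c' 1 - c 1 * c' 0) * (r 0 * r' 1 - r 1 * r' 0).
have d0 : d = 0 by rewrite -[RHS]oppr0 -det0 /d; ring.
rewrite -(mulr0 (r i * r' j * c k * c' l)) -d0 /d; ring.
Qed.

Lemma col_parallel_annihilator a : a != 0 ->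
  exists2 w : 'rV[F]_2, w != 0 & forall b, col_parallel a b -> w *m b = 0.
Proof.
move=> a0; have [l al] := nonzero_col a0.
(* This row is orthogonal to the nonzero column [l] of [a], hence to every column parallel to it. *)
exists (\row_i (if i == 0 then - a 1 l else a 0 l)).
  apply/negP=> /eqP/rowP w0; have := w0 0; have := w0 1; rewrite !mxE /=.
  by move=> a0l /eqP; rewrite oppr_eq0 => /eqP a1l; move: al; rewrite a0l a1l eqxx.
move=> b /col_parallelP ab; apply/rowP=> j.
rewrite !mxE !big_ord_recl big_ord0 !mxE /=.
have -> : lift 0 0 = 1 :> 'I_2 by apply: val_inj.
by rewrite addr0 mulNr ab addNr.
Qed.

End Singular2.

Section Converse.
Variables (R : finUnitRingType) (F : finFieldType).

Lemma well_covered_field (f : {rmorphism R -> F}) :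
    (forall x, x \is a GRing.unit <-> exists y, y * f x = 1) ->
  well_covered (@unitary_cayley R).
Proof.
move=> uf; have uN x : x \isn't a GRing.unit -> f x = 0.
  move/negP=> nu; apply/eqP; apply: contraT => fx0.
  by case: nu; apply/uf; exists (f x)^-1; rewrite mulVf.
apply: (@well_covered_intro _ #|[set x | f x == 0]|) => A indA domA A0.
congr #|pred_of_set _|; apply: nonunit_diff_maximal => //.
  move=> x y; rewrite !inE => /eqP fx /eqP fy; apply/negP => /uf[z].
  by rewrite rmorphB fx fy subrr mulr0 => /esym/eqP; rewrite oner_eq0.
by apply/subsetP=> x xA; rewrite inE uN // -[x]subr0 indA.
Qed.

(** A nonunit difference vanishes in one coordinate, so all of [A] agrees in the first coordinate or
    all of it in the second. Thus [A] is the kernel of a coordinate map, and both kernels have the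
    same index [#|F|]. *)
Lemma well_covered_field_pair (f : {rmorphism R -> (F * F)%type}) :
    (forall t, exists r, f r = t) ->
    (forall x, x \is a GRing.unit <-> exists y, y * f x = 1) ->
  well_covered (@unitary_cayley R).
Proof.
move=> surj uf.
pose f1 : {additive R -> F} := (fst \o f : {additive R -> F}).
pose f2 : {additive R -> F} := (snd \o f : {additive R -> F}).
have f1s w : exists v, f1 v = w by have [r fr] := surj (w, 0); exists r; rewrite /= fr.
have f2s w : exists v, f2 v = w by have [r fr] := surj (0, w); exists r; rewrite /= fr.
have card12 : #|[set x | f2 x == 0]| = #|[set x | f1 x == 0]|.
  have F0 : (0 < #|F|)%N by apply/card_gt0P; exists 0.
  by apply/eqP; rewrite -(eqn_pmul2l F0) !card_kernel_additive.
have uN x : x \isn't a GRing.unit -> (f1 x == 0) || (f2 x == 0).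
  apply: contraNT; rewrite negb_or => /andP[n1 n2]; apply/uf.
  by exists ((f1 x)^-1, (f2 x)^-1); congr (_, _); rewrite /= mulVf.
have Nu x : f1 x = 0 \/ f2 x = 0 -> x \isn't a GRing.unit.
  move=> fx0; apply/negP => /uf[y]; case: fx0 => fx0.
    by move/(congr1 fst)/eqP; rewrite /= [X in _ * X]fx0 mulr0 eq_sym oner_eq0.
  by move/(congr1 snd)/eqP; rewrite /= [X in _ * X]fx0 mulr0 eq_sym oner_eq0.
apply: (@well_covered_intro _ #|[set x | f1 x == 0]|) => A indA domA A0.
have [] := @all_related_by_one _ A (fun x y => f1 x == f1 y) (fun x y => f2 x == f2 y).
- by move=> x y; exact: eq_sym.
- by move=> x y; exact: eq_sym.
- by move=> x y z _ _ _ /eqP->.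
- by move=> x y z _ _ _ /eqP->.
- by move=> x y xA yA; have := uN _ (indA _ _ xA yA); rewrite !raddfB !subr_eq0.
- move=> all1; congr #|pred_of_set _|; apply: nonunit_diff_maximal => //.
    move=> x y; rewrite !inE => /eqP fx /eqP fy; apply: Nu; left.
    by rewrite raddfB fx fy subrr.
  by apply/subsetP=> x xA; rewrite inE -(raddf0 f1); exact: all1.
- move=> all2; rewrite -card12; congr #|pred_of_set _|;
  apply: nonunit_diff_maximal => //.
    move=> x y; rewrite !inE => /eqP fx /eqP fy; apply: Nu; right.
    by rewrite raddfB fx fy subrr.
  by apply/subsetP=> x xA; rewrite inE -(raddf0 f2); exact: all2.
Qed.

(** A maximal independent set containing 0 is some [rowm w] or [colm w^T] with [w] nonzero, and each
    of these is the kernel of a surjection onto a space of order [#|F| ^ 2]. *)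
Lemma well_covered_mx2 (f : {rmorphism R -> 'M[F]_2}) :
    (forall t, exists r, f r = t) ->
    (forall x, x \is a GRing.unit <-> exists y, y * f x = 1) ->
  well_covered (@unitary_cayley R).
Proof.
move=> surj uf.
have detP x : (x \is a GRing.unit) = (\det (f x) != 0).
  rewrite -unitfE -unitmxE; apply/idP/idP => [/uf[y]|ufx].
    by move/mulmx1_unit => [].
  by apply/uf; exists (f x)^-1; rewrite mulVr.
pose rowf (w : 'rV[F]_2) : {additive R -> 'rV[F]_2} :=
  (mulmx w \o f : {additive R -> 'rV[F]_2}).
pose colf (v : 'cV[F]_2) : {additive R -> 'cV[F]_2} :=
  (mulmxr v \o f : {additive R -> 'cV[F]_2}).
have nz (w : 'rV[F]_2) : w != 0 -> exists k, w 0 k != 0.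
  move=> w0; apply/existsP; apply: contraR w0.
  rewrite negb_exists => /forallP w0.
  by apply/eqP/rowP => k; rewrite mxE; apply/eqP/negPn.
pose rowm w := [set x | rowf w x == 0].
pose colm v := [set x | colf v x == 0].
have F0 : (0 < #|F| ^ 2)%N by rewrite expn_gt0; apply/orP; left;
  apply/card_gt0P; exists 0.
have card_row w : w != 0 -> #|rowm w| = (#|R| %/ #|F| ^ 2)%N.
  move=> /nz[k wk].
  rewrite -(@card_kernel_additive _ _ (rowf w)) ?card_mx ?mulKn // => r.
  have [x fx] := surj ((w 0 k)^-1 *: (delta_mx k 0 *m r)); exists x.
  rewrite /= fx -scalemxAr mulmxA -colE; apply/rowP=> j.
  by rewrite !mxE big_ord1 !mxE mulrA mulVf ?mul1r.
have card_col w : w != 0 -> #|colm w^T| = (#|R| %/ #|F| ^ 2)%N.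
  move=> /nz[k wk].
  rewrite -(@card_kernel_additive _ _ (colf w^T)) ?card_mx ?mulKn // => c.
  have [x fx] := surj ((w 0 k)^-1 *: (c *m delta_mx 0 k)); exists x.
  rewrite /= fx -scalemxAl -mulmxA -rowE; apply/colP=> j.
  by rewrite !mxE big_ord1 !mxE mulrCA mulVf ?mulr1.
have ind_row w : w != 0 -> nonunit_diff (rowm w).
  move=> w0 x y; rewrite !inE => /eqP wx /eqP wy; rewrite detP negbK.
  apply/det0P; exists w => //; rewrite -[LHS]/(rowf w (x - y)).
  by rewrite raddfB wx wy subrr.
have ind_col w : w != 0 -> nonunit_diff (colm w^T).
  move=> w0 x y; rewrite !inE => /eqP wx /eqP wy; rewrite detP negbK -det_tr.
  apply/det0P; exists w => //; apply: trmx_inj; rewrite trmx_mul trmxK trmx0.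
  by rewrite -[LHS]/(colf w^T (x - y)) raddfB wx wy subrr.
apply: (@well_covered_intro _ (#|R| %/ #|F| ^ 2)%N) => A indA domA A0.
(* Elements over the zero matrix are set aside: 0 is parallel to everything and would break
   transitivity. *)
pose A' := [set x in A | f x != 0].
have pickA (P : rel 'M[F]_2) : (forall a, P a 0) ->
    {in A' &, forall x y, P (f x) (f y)} ->
  exists2 a, a != 0 & forall x, x \in A -> P a (f x).
  move=> P0 allP; have [a aA'|noA'] := pickP (mem A').
    have /setIdP[_ fa0] : a \in A' by []; exists (f a) => // x xA.
    by have [->//|fx0] := eqVneq (f x) 0; apply: allP; rewrite // inE xA.
  (* If all of [A] lies over 0, any nonzero matrix can serve as the reference. *)
  exists 1; first exact: oner_neq0.
  by move=> x xA; have := noA' x; rewrite !inE xA /= => /negbFE/eqP->.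
have sing x : x \in A -> \det (f x) = 0.
  by move=> xA; apply/eqP/negPn; rewrite -detP -[x]subr0 indA.
have par0 a : col_parallel a 0 by apply/col_parallelP => i j; rewrite !mxE !mulr0.
have [] := @all_related_by_one _ A' (fun x y => col_parallel (f x) (f y))
                                    (fun x y => col_parallel (f x)^T (f y)^T).
- by move=> x y; exact: col_parallel_sym.
- by move=> x y; exact: col_parallel_sym.
- move=> y x z /setIdP[_ fy0] _ _; exact: col_parallel_trans.
- move=> y x z /setIdP[_ fy0] _ _; apply: col_parallel_trans.
  by rewrite -trmx0 (inj_eq (@trmx_inj _ _ _)).
- move=> x y /setIdP[xA _] /setIdP[yA _]; apply: singular2_parallel.
  + exact: sing.
  + exact: sing.
  + by apply/eqP/negPn; rewrite -rmorphB -detP indA.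
- case/pickA => // a a0 Aa; have [w w0 wA] := col_parallel_annihilator a0.
  rewrite -(card_row w w0); congr #|pred_of_set _|.
  apply: nonunit_diff_maximal => //; first exact: ind_row.
  by apply/subsetP=> x xA; rewrite inE; apply/eqP/wA/Aa.
- case/(pickA (fun a b => col_parallel a^T b^T)) => [b|a a0 Aa].
    by rewrite trmx0.
  have aT0 : a^T != 0 by rewrite -trmx0 (inj_eq (@trmx_inj _ _ _)).
  have [w w0 wA] := col_parallel_annihilator aT0.
  rewrite -(card_col w w0); congr #|pred_of_set _|.
  apply: nonunit_diff_maximal => //; first exact: ind_col.
  apply/subsetP=> x xA; rewrite inE; apply/eqP.
  by apply: trmx_inj; rewrite /= trmx_mul trmxK trmx0; apply/wA/Aa.
Qed.

End Converse.

(** The units are exactly the elements over 1, and [A + 1] turns out to be the complement of [A], so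
    [A] has half the order of [R]. *)
Lemma well_covered_Z2 (R : finUnitRingType) k
    (f : {rmorphism R -> {ffun 'I_k -> 'Z_2}}) :
    (forall x, x \is a GRing.unit <-> exists y, y * f x = 1) ->
  well_covered (@unitary_cayley R).
Proof.
move=> uf; have Z2 (c : 'Z_2) : c = 0 \/ c = 1.
  by case: c => [[|[|m]] // ltm]; [left|right]; apply: val_inj.
have f2 (c : {ffun 'I_k -> 'Z_2}) : c + c = 0.
  by apply/ffunP=> i; rewrite !ffunE; case: (Z2 (c i)) => ->; apply: val_inj.
have unitP x : x \is a GRing.unit <-> f x = 1.
  split=> [/uf[y yfx]|fx]; last by apply/uf; exists 1; rewrite mul1r.
  apply/ffunP=> i; have /ffunP/(_ i) := yfx; rewrite !ffunE.
  by case: (Z2 (f x i)) => // ->; rewrite mulr0.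
apply: (@well_covered_intro _ #|R|./2) => A indA domA A0.
suff: (#|A| + #|A|)%N = #|R| by move=> <-; rewrite addnn doubleK.
rewrite -(cardC (mem A)); congr addn; rewrite -(card_imset _ (addIr 1)).
apply: eq_card => x; rewrite [RHS]inE /=; apply/imsetP/idP => [[y yA ->]|xA].
  apply/negP => y1A; have /negP[] := indA _ _ y1A yA.
  by rewrite addrC addKr unitr1.
exists (x - 1); last by rewrite subrK.
(* If [x] and [x - 1] both avoided [A], their dominating elements [a] and [b] would satisfy
   [f a - f b = 1], making [a - b] a unit. *)
apply: contraT => /domA[b bA /unitP]; rewrite !rmorphB rmorph1 => e.
have [a aA /unitP] := domA _ xA; rewrite rmorphB => e'.
have /negP[] := indA _ _ aA bA; apply/unitP; rewrite rmorphB.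
have -> : f a = f x - 1 by rewrite -e' opprB addrC subrK.
exact: e.
Qed.

(** * Primitive idempotents *)

Section PrimitiveIdempotents.
Variable S : finUnitRingType.
Implicit Types e f x y : S.

(** The last clause says that [S e] is a minimal left ideal: each of its nonzero elements generates
    it. *)
Definition primitive_idem e : Prop :=
  [/\ e != 0, e * e = e & forall x, x * e != 0 -> exists y, y * (x * e) = e].

(** The maximal left ideals intersect in 0, that is, the Jacobson radical vanishes; for a finite
    ring this is semisimplicity. *)
Definition semisimple : Prop :=
  forall x, x != 0 -> exists2 M : {set S}, maximal_left_ideal M & x \notin M.

(** The left ideal [N = M + S x] strictly contains [M], so it is not proper. *)
Lemma maximal_left_ideal_add M x : maximal_left_ideal M -> x \notin M ->
  exists y, 1 - y * x \in M.
Proof.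
move=> maxM xM; have [M0 M1 Mlin] := maximal_left_idealW maxM.
have Mopp a : a \in M -> - a \in M.
  by move=> aM; have := Mlin (-1) _ _ aM M0; rewrite mulN1r addr0.
pose N := [set a | [exists y, a - y * x \in M]].
have NP a : reflect (exists y, a - y * x \in M) (a \in N).
  by rewrite inE; exact: existsP.
have xN : x \in N by apply/NP; exists 1; rewrite mul1r subrr.
apply/NP; apply: contraT => N1; case/negP: xM; suff <- : N = M by [].
case/maxsetP: maxM => _; apply; last first.
  by apply/subsetP=> a aM; apply/NP; exists 0; rewrite mul0r subr0.
apply/proper_left_idealP; split=> //.
  by apply/NP; exists 0; rewrite mul0r subr0.
move=> a u v /NP[b ub] /NP[c vc]; apply/NP; exists (a * b + c).
by rewrite mulrDl opprD addrACA -mulrA -mulrBr; exact: Mlin.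
Qed.

(** Choose a nonzero [x] in [S f] with [S x] of least order, a maximal left ideal [M] missing [x],
    and [y] with [1 - y x] in [M]. Then [x y x = x], so [y x] is an idempotent generating the
    minimal left ideal [S x]. *)
Lemma primitive_below f : semisimple -> f != 0 -> f * f = f ->
  exists e, [/\ primitive_idem e, e * f = e & f * e = e].
Proof.
move=> ssS f0 ff.
pose P x := (x != 0) && (x * f == x).
have Pf : P f by rewrite /P f0 ff eqxx.
have [x /andP[x0 /eqP xf] minx] := arg_minnP (fun x => #|[set y * x | y : S]|) Pf.
have xmin z : z * x != 0 -> exists t, t * (z * x) = x.
  move=> zx0; have Pzx : P (z * x) by rewrite /P zx0 -mulrA xf eqxx.
  have sub : [set y * (z * x) | y : S] \subset [set y * x | y : S].
    by apply/subsetP=> _ /imsetP[y _ ->]; apply/imsetP; exists (y * z); rewrite ?mulrA.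
  have /eqP eqL : [set y * (z * x) | y : S] == [set y * x | y : S].
    by rewrite eqEcard sub minx.
  have : x \in [set y * x | y : S] by apply/imsetP; exists 1; rewrite ?mul1r.
  by rewrite -eqL => /imsetP[t _ xt]; exists t.
have [M maxM xM] := ssS x x0; have [M0 _ Mlin] := maximal_left_idealW maxM.
have [y yM] := maximal_left_ideal_add maxM xM.
have xl : x * (y * x) = x.
  (* Otherwise [x (1 - y x)] is a nonzero element of both [S x] and [M]; by minimality it generates
     [S x], which puts [x] in [M]. *)
  apply/eqP; apply: contraT => neq; case/negP: xM.
  have d0 : (1 - x * y) * x != 0 by rewrite mulrBl mul1r -mulrA subr_eq0 eq_sym.
  have [t <-] := xmin _ d0.
  have -> : (1 - x * y) * x = x * (1 - y * x).
    by rewrite mulrBl mulrBr mul1r mulr1 mulrA.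
  by have := Mlin (t * x) _ _ yM M0; rewrite addr0 -mulrA.
set l := y * x in xl.
have lf : l * f = l by rewrite -mulrA xf.
have ll : l * l = l by rewrite -{1}/l -{1}mulrA xl.
have l0 : l != 0 by apply: contraNneq x0 => l0; rewrite -xl l0 mulr0.
have lfl : l * (f * l) = l by rewrite mulrA lf ll.
(* [l] absorbs [f] only on the right; multiplying by [f] on the left makes it absorb [f] on both
   sides. *)
exists (f * l); split; last 1 first.
- by rewrite mulrA ff.
- split.
  + by apply: contraNneq l0 => fl0; rewrite -lfl fl0 mulr0.
  + by rewrite -mulrA lfl.
  + move=> z zfl0; have [|t tx] := xmin (z * f * y).
      by move: zfl0; rewrite !mulrA.
    by exists (f * y * t); rewrite -!mulrA; congr (f * (y * _));
      rewrite -[RHS]tx !mulrA.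
- by rewrite -mulrA lf.
Qed.

Definition orthogonal_primitives (E : {set S}) : Prop :=
  {in E, forall e, primitive_idem e} /\ {in E &, forall e f, e != f -> e * f = 0}.

Lemma orthogonal_mul_sum (E D : {set S}) e :
    orthogonal_primitives E -> D \subset E -> e \in E ->
  e * (\sum_(f in D) f) = (if e \in D then e else 0) /\
  (\sum_(f in D) f) * e = (if e \in D then e else 0).
Proof.
case=> prim orth sDE eE; have [_ ee _] := prim e eE.
rewrite mulr_sumr mulr_suml; case: ifP => eD.
  rewrite !(bigD1 e eD) /= ee !big1 ?addr0 // => f /andP[/(subsetP sDE) fE nfe].
    exact: orth.
  by rewrite orth // eq_sym.
by rewrite !big1 // => f fD; have fE := subsetP sDE f fD; rewrite orth //;
   apply: contraFneq eD => ef; rewrite ?ef // -?ef.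
Qed.

Lemma orthogonal_sum_idem (E D : {set S}) :
  orthogonal_primitives E -> D \subset E ->
  (\sum_(f in D) f) * (\sum_(f in D) f) = \sum_(f in D) f.
Proof.
move=> orth sDE; rewrite mulr_suml; apply: eq_bigr => e eD.
by have [-> _] := orthogonal_mul_sum orth sDE (subsetP sDE e eD); rewrite eD.
Qed.

(** Take a maximal orthogonal family with sum [s]. If [1 - s] were nonzero, a primitive idempotent
    below it would be orthogonal to the whole family and enlarge it. The boolean forms [pb] and [P]
    allow [maxset] to be used. *)
Lemma complete_orthogonal_primitives : semisimple ->
  exists2 E : {set S}, orthogonal_primitives E & \sum_(e in E) e = 1.
Proof.
move=> ssS.
pose pb e := [&& e != 0, e * e == e
               & [forall x, (x * e != 0) ==> [exists y, y * (x * e) == e]]].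
have pbP e : reflect (primitive_idem e) (pb e).
  apply: (iffP and3P) => [[e0 /eqP ee pe]|[e0 ee pe]].
    split=> // x xe; apply/exists_eqP.
    by have /forallP/(_ x)/implyP := pe; apply.
  split; rewrite ?ee //; apply/forallP=> x; apply/implyP=> /pe[y ye].
  by apply/existsP; exists y; rewrite ye.
pose P (E : {set S}) :=
  [forall e in E, pb e] && [forall e in E, forall f in E, (e != f) ==> (e * f == 0)].
have PP E : reflect (orthogonal_primitives E) (P E).
  apply: (iffP andP) => [[/forall_inP prim /forall_inP orth]|[prim orth]].
    split=> [e /prim/pbP // | e f eE fE nef].
    by have /forall_inP/(_ f fE)/implyP/(_ nef)/eqP := orth e eE.
  split; apply/forall_inP=> e eE; first exact/pbP/prim.
  by apply/forall_inP=> f fE; apply/implyP=> nef; rewrite orth.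
have P0 : P set0 by apply/PP; split=> e; rewrite inE.
have [E /maxsetP[/PP orthE maxE] _] := maxset_exists P0.
exists E => //; apply/eqP; rewrite eq_sym -subr_eq0; apply: contraT => f0.
set s := \sum_(e in E) e in f0 *.
have ss : s * s = s := orthogonal_sum_idem orthE (subxx E).
have ff : (1 - s) * (1 - s) = 1 - s.
  by rewrite mulrBl mul1r mulrBr mulr1 ss subrr subr0.
have [g [pg gf fg]] := primitive_below ssS f0 ff.
have ge e : e \in E -> g * e = 0.
  move=> eE; have [_ se] := orthogonal_mul_sum orthE (subxx E) eE.
  by rewrite -gf -mulrA mulrBl mul1r se eE subrr mulr0.
have eg e : e \in E -> e * g = 0.
  move=> eE; have [es _] := orthogonal_mul_sum orthE (subxx E) eE.
  by rewrite -fg mulrA mulrBr mulr1 es eE subrr mul0r.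
have gE : g \notin E.
  apply/negP=> gE; have [/eqP g0 gg _] := pg; case: g0.
  by rewrite -gg ge.
case/negP: gE; suff <- : g |: E = E by rewrite setU11.
apply: maxE (subsetUr _ _); have [prim orth] := orthE; apply/PP; split.
  by move=> e /setU1P[->|/prim].
move=> e e' /setU1P[->|eE] /setU1P[->|e'E]; rewrite ?eqxx //.
- by rewrite ge.
- by rewrite eg.
- exact: orth.
Qed.

End PrimitiveIdempotents.

(** * Peirce corners *)

Section Corners.
Variable S : finUnitRingType.
Implicit Types e f g x y : S.

(** For idempotents this is the Peirce component [e S f], given as the fixed points of its
    projection; [corner 1 e] is the left ideal [S e]. *)
Definition corner e f := [set x | e * x * f == x].
Definition left_ideal x := [set r * x | r : S].

Lemma cornerP e f x : e * e = e -> f * f = f ->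
  reflect (e * x = x /\ x * f = x) (x \in corner e f).
Proof.
move=> ee ff; rewrite inE; apply: (iffP eqP) => [<-|[ex xf]].
  by rewrite !mulrA ee -!mulrA ff.
by rewrite ex xf.
Qed.

Lemma mem_corner e f x : e * e = e -> f * f = f -> e * x * f \in corner e f.
Proof. by move=> ee ff; apply/cornerP; rewrite // !mulrA ee -!mulrA ff. Qed.

Lemma left_idealE e : e * e = e -> left_ideal e = corner 1 e.
Proof.
move=> ee; apply/setP=> x; apply/imsetP/(cornerP _ (mulr1 1) ee).
  by case=> r _ ->; rewrite mul1r -mulrA ee.
by case=> _ xe; exists x.
Qed.

Lemma corner0 e f : 0 \in corner e f.
Proof. by rewrite inE mulr0 mul0r. Qed.

Lemma card_corner_gt0 e f : (0 < #|corner e f|)%N.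
Proof. by apply/card_gt0P; exists 0; exact: corner0. Qed.

(** Peirce decomposition: [(e + g) S f] is the direct sum of [e S f] and [g S f]. *)
Lemma card_cornerDl e g f : e * e = e -> g * g = g -> f * f = f ->
    e * g = 0 -> g * e = 0 ->
  #|corner (e + g) f| = (#|corner e f| * #|corner g f|)%N.
Proof.
move=> ee gg ff eg ge.
have hh : (e + g) * (e + g) = e + g by rewrite mulrDl !mulrDr ee eg ge gg addr0 add0r.
rewrite -cardsX -(@card_in_imset _ _ (fun p : S * S => p.1 + p.2)).
  apply: eq_card => x; apply/(cornerP _ hh ff)/imsetP.
    case=> hx xf; exists (e * x, g * x); last by rewrite /= -mulrDl.
    by apply/setXP; split; apply/cornerP => //=; rewrite mulrA ?ee ?gg -mulrA xf.
  case=> -[a b] /setXP[/(cornerP _ ee ff)[/= ea af] /(cornerP _ gg ff)[/= gb bf]] ->.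
  have ga : g * a = 0 by rewrite -ea mulrA ge mul0r.
  have eb : e * b = 0 by rewrite -gb mulrA eg mul0r.
  by rewrite mulrDl !mulrDr ea eb ga gb addr0 add0r mulrDl af bf.
move=> [a b] [c d] /setXP[/(cornerP _ ee ff)[/= ea _] /(cornerP _ gg ff)[/= gb _]].
move=> /setXP[/(cornerP _ ee ff)[/= ec _] /(cornerP _ gg ff)[/= gd _]] eq.
have ga : g * a = 0 by rewrite -ea mulrA ge mul0r.
have eb : e * b = 0 by rewrite -gb mulrA eg mul0r.
have gc : g * c = 0 by rewrite -ec mulrA ge mul0r.
have ed : e * d = 0 by rewrite -gd mulrA eg mul0r.
congr (_, _).
  by have := congr1 ( *%R e) eq; rewrite !mulrDr ea ec eb ed !addr0.
by have := congr1 ( *%R g) eq; rewrite !mulrDr ga gc gb gd !add0r.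
Qed.

Lemma card_cornerDr e g f : e * e = e -> g * g = g -> f * f = f ->
    e * g = 0 -> g * e = 0 ->
  #|corner f (e + g)| = (#|corner f e| * #|corner f g|)%N.
Proof.
move=> ee gg ff eg ge.
have hh : (e + g) * (e + g) = e + g by rewrite mulrDl !mulrDr ee eg ge gg addr0 add0r.
rewrite -cardsX -(@card_in_imset _ _ (fun p : S * S => p.1 + p.2)).
  apply: eq_card => x; apply/(cornerP _ ff hh)/imsetP.
    case=> fx xh; exists (x * e, x * g); last by rewrite /= -mulrDr.
    by apply/setXP; split; apply/cornerP => //=; rewrite -mulrA ?ee ?gg mulrA fx.
  case=> -[a b] /setXP[/(cornerP _ ff ee)[/= fa ae] /(cornerP _ ff gg)[/= fb bg]] ->.
  have ag : a * g = 0 by rewrite -ae -mulrA eg mulr0.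
  have be : b * e = 0 by rewrite -bg -mulrA ge mulr0.
  by rewrite mulrDr !mulrDl !mulrDr ae be ag bg addr0 add0r fa fb.
move=> [a b] [c d] /setXP[/(cornerP _ ff ee)[/= _ ae] /(cornerP _ ff gg)[/= _ bg]].
move=> /setXP[/(cornerP _ ff ee)[/= _ ce] /(cornerP _ ff gg)[/= _ dg]] eq.
have ag : a * g = 0 by rewrite -ae -mulrA eg mulr0.
have be : b * e = 0 by rewrite -bg -mulrA ge mulr0.
have cg : c * g = 0 by rewrite -ce -mulrA eg mulr0.
have de : d * e = 0 by rewrite -dg -mulrA ge mulr0.
congr (_, _).
  by have := congr1 ( *%R^~ e) eq; rewrite /= !mulrDl ae ce be de !addr0.
by have := congr1 ( *%R^~ g) eq; rewrite /= !mulrDl ag cg bg dg !add0r.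
Qed.

Lemma leq_left_idealM x y : (#|left_ideal (x * y)%R| <= #|left_ideal y|)%N.
Proof.
apply/subset_leq_card/subsetP => _ /imsetP[r _ ->].
by apply/imsetP; exists (r * x); rewrite ?mulrA.
Qed.

Lemma leq_left_idealMr x y : (#|left_ideal (x * y)%R| <= #|left_ideal x|)%N.
Proof.
have -> : left_ideal (x * y) = *%R^~ y @: left_ideal x; last exact: leq_imset_card.
by rewrite -imset_comp; apply: eq_imset => r /=; rewrite mulrA.
Qed.

Lemma leq_left_idealB x y :
  (#|left_ideal (x - y)%R| <= #|left_ideal x| * #|left_ideal y|)%N.
Proof.
rewrite -cardsX; apply: leq_trans (leq_imset_card (fun p : S * S => p.1 - p.2) _).
apply/subset_leq_card/subsetP => _ /imsetP[r _ ->].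
apply/imsetP; exists (r * x, r * y); last by rewrite mulrBr.
by apply/setXP; split; apply: imset_f.
Qed.

(** Equivalently, the left modules [S e] and [S f] are isomorphic. *)
Definition isomorphic_idempotents e f :=
  exists u v, [/\ u \in corner e f, v \in corner f e, u * v = e & v * u = f].

Lemma primitive_isomorphic e f u : primitive_idem e -> primitive_idem f ->
  u \in corner e f -> u != 0 -> isomorphic_idempotents e f.
Proof.
move=> [e0 ee pe] [f0 ff pf] /(cornerP _ ee ff)[eu uf] u0.
have [|y yu] := pf u; first by rewrite uf.
rewrite uf in yu; pose v := f * y * e.
have vu : v * u = f by rewrite /v -mulrA eu -mulrA yu.
have vP : v \in corner f e by exact: mem_corner.
have /(cornerP _ ff ee)[fv ve] := vP.
exists u, v; split=> //; first by apply/cornerP.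
have uve : u * v * e = u * v by rewrite -mulrA ve.
have [|t tuv] := pe (u * v).
  rewrite uve; apply: contraNneq f0 => uv0.
  by rewrite -ff -vu -mulrA [u * _]mulrA uv0 mul0r mulr0.
rewrite uve in tuv.
have ww : u * v * (u * v) = u * v by rewrite -mulrA [v * _]mulrA vu mulrA uf.
by have := congr1 ( *%R t) ww; rewrite [t * (_ * _)]mulrA tuv mulrA eu.
Qed.

Lemma isomorphic_card_cornerl e f g : e * e = e -> f * f = f -> g * g = g ->
  isomorphic_idempotents e f -> #|corner e g| = #|corner f g|.
Proof.
move=> ee ff gg [u [v [/(cornerP _ ee ff)[eu uf] /(cornerP _ ff ee)[fv ve] uv vu]]].
rewrite -(@card_in_imset _ _ ( *%R v)).
  apply: eq_card => x; apply/imsetP/(cornerP _ ff gg).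
    by case=> y /(cornerP _ ee gg)[ey yg] ->; rewrite mulrA fv -mulrA yg.
  case=> fx xg; exists (u * x); last by rewrite mulrA vu.
  by apply/cornerP; rewrite // mulrA eu -mulrA xg.
move=> x y /(cornerP _ ee gg)[ex _] /(cornerP _ ee gg)[ey _].
by move=> /(congr1 ( *%R u)); rewrite !mulrA uv ex ey.
Qed.

Lemma isomorphic_card_cornerr e f g : e * e = e -> f * f = f -> g * g = g ->
  isomorphic_idempotents e f -> #|corner g e| = #|corner g f|.
Proof.
move=> ee ff gg [u [v [/(cornerP _ ee ff)[eu uf] /(cornerP _ ff ee)[fv ve] uv vu]]].
rewrite -(@card_in_imset _ _ ( *%R^~ u)).
  apply: eq_card => x; apply/imsetP/(cornerP _ gg ff).
    by case=> y /(cornerP _ gg ee)[gy ye] ->; rewrite mulrA gy -mulrA uf.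
  case=> gx xf; exists (x * v); last by rewrite -mulrA vu.
  by apply/cornerP; rewrite // mulrA gx -mulrA ve.
move=> x y /(cornerP _ gg ee)[_ xe] /(cornerP _ gg ee)[_ ye].
by move=> /(congr1 ( *%R^~ v)); rewrite /= -!mulrA uv xe ye.
Qed.

(** Left multiplication by [x] is injective on the right ideal [e S], with a left inverse given by
    [y]. *)
Definition faithful_on x e := exists y, y * (x * e) = e.

Lemma faithful_on_primitive x e : primitive_idem e -> x * e != 0 -> faithful_on x e.
Proof. by case=> _ _ pe /pe. Qed.

(** Gaussian elimination on the columns [x e] and [x f]: either the second is a right multiple of
    the first, or the remainder [d] is nonzero and supplies a second pivot. *)
Lemma primitive_pair x e f :
  primitive_idem e -> primitive_idem f -> e * f = 0 -> f * e = 0 ->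
    x * e != 0 ->
  (exists2 h, h \in corner e f & x * f = x * e * h) \/ faithful_on x (e + f).
Proof.
move=> pe pf ef fe xe0; have [e0 ee re] := pe; have [f0 ff rf] := pf.
have [t0 t0x] := re x xe0; pose t := e * t0.
have tx : t * (x * e) = e by rewrite -mulrA t0x.
pose h := t * (x * f).
have hP : h \in corner e f by apply/cornerP; rewrite // /h /t !mulrA ?ee // -!mulrA ff.
have [eh hf] := cornerP _ ee ff hP.
have [->|neq] := eqVneq (x * f) (x * e * h); first by left; exists h.
right; pose d := (x - x * e * t * x) * f.
have dE : d = x * f - x * e * h by rewrite /d mulrBl /h !mulrA.
have [|y yd] := rf (x - x * e * t * x); first by rewrite -/d dE subr_eq0.
pose c := y * (1 - x * e * t).
have cxe : c * (x * e) = 0.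
  by rewrite /c -mulrA mulrBl mul1r -[x * e * t * _]mulrA tx -mulrA ee subrr mulr0.
have cxf : c * (x * f) = f.
  by rewrite -[RHS]yd /c -mulrA; congr (y * _); rewrite !mulrBl mul1r !mulrA.
(* [t] sends [x e] to [e] and [x f] to [h], while [c] kills [x e] and sends [x f] to [f]; the term
   [- h * c] cancels the stray [h]. *)
exists (t - h * c + c).
rewrite !mulrDr; congr (_ + _); rewrite !mulrDl mulNr -(mulrA h).
  by rewrite tx cxe mulr0 subr0 addr0.
by rewrite cxf hf subrr add0r.
Qed.

End Corners.

(** * Extending a partial left inverse to a unit *)

Section UnitExtension.
Variable S : finUnitRingType.
Implicit Types a e s x y : S.

(** The idempotent [p = 1 - b z] kills [b] on its right and is killed by [z] on its left. Any
    nonzero [w] in [p S e] is therefore independent of [b], and [z] can be corrected by a multiple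
    of [p] to invert both. *)
Lemma faithful_on_extend a s e : s * s = s -> primitive_idem e ->
    s * e = 0 -> e * s = 0 -> faithful_on a s ->
  exists2 w, w * e = w & faithful_on (a * s + w) (s + e).
Proof.
move=> ss [e0 ee re] se es [z0 z0a]; pose z := s * z0; pose b := a * s.
have zb : z * b = s by rewrite -mulrA z0a.
have bs : b * s = b by rewrite -mulrA ss.
have sz : s * z = z by rewrite mulrA ss.
pose p := 1 - b * z.
have zp : z * p = 0 by rewrite mulrBr mulr1 mulrA zb sz subrr.
have pb : p * b = 0 by rewrite mulrBl mul1r -mulrA zb bs subrr.
have pp : p * p = p by rewrite {1}/p mulrBl mul1r -mulrA zp mulr0 subr0.
have [r pre] : exists r, p * r * e != 0.
  (* If [p S e] were 0, left multiplication by [z] would embed [S e] into itself; it misses [e],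
     because its values are fixed by [s] and [s e = 0]. Finiteness forbids this. *)
  apply/existsP; apply: contraT; rewrite negb_exists => /forallP p0.
  have inj : {in corner 1 e &, injective ( *%R z)}.
    suff bz x : x \in corner 1 e -> b * (z * x) = x.
      by move=> x y xe ye /(congr1 ( *%R b)); rewrite !bz.
    move=> /(cornerP _ (mulr1 1) ee)[_ xe]; have /eqP := negPn (p0 x).
    by rewrite -mulrA xe mulrBl mul1r => /eqP; rewrite subr_eq0 mulrA => /eqP.
  have : (#|corner 1%R e| <= #|corner 1%R e :\ e|)%N.
    rewrite -(card_in_imset inj); apply/subset_leq_card/subsetP.
    move=> _ /imsetP[x /(cornerP _ (mulr1 1) ee)[_ xe] ->]; apply/setD1P; split.
      apply: contraNneq e0 => zx.
      by rewrite -ee -{1}zx -sz -[s * z * x]mulrA zx se mul0r.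
    by apply/cornerP; rewrite ?mulr1 // mul1r -mulrA xe.
  by rewrite [X in (X <= _)%N](cardsD1 e) inE mul1r ee eqxx ltnn.
have [y0 y0w] := re _ pre.
pose w := p * r * e; exists w; first by rewrite -mulrA ee.
have zw : z * w = 0 by rewrite /w !mulrA zp !mul0r.
have pw : p * w = w by rewrite /w !mulrA pp.
have we : w * e = w by rewrite -mulrA ee.
have ws : w * s = 0 by rewrite -we -mulrA es mulr0.
have be : b * e = 0 by rewrite -bs -mulrA se mulr0.
exists (z + y0 * p); rewrite -/b.
have -> : (b + w) * (s + e) = b + w by rewrite mulrDr !mulrDl bs ws be we addr0 add0r.
by rewrite mulrDr !mulrDl zb zw add0r -!(mulrA y0) pb mulr0 addr0 pw [y0 * w]y0w.
Qed.

(** The idempotents outside [D] are added one at a time; once their sum is 1, being faithful means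
    having a left inverse. *)
Lemma faithful_on_extend_unit (E D : {set S}) a :
    orthogonal_primitives E -> \sum_(e in E) e = 1 -> D \subset E ->
    faithful_on a (\sum_(e in D) e) ->
  exists2 u, u \is a GRing.unit & u * \sum_(e in D) e = a * \sum_(e in D) e.
Proof.
move=> orthE sum1; have [n] := ubnP #|E :\: D|.
elim: n D a => // n IHn D a leDn sDE aD.
have [sED|/subsetPn[e eE eD]] := boolP (E \subset D).
  have DE : D = E by apply/eqP; rewrite eqEsubset sDE.
  move: aD; rewrite DE sum1 => -[y]; rewrite mulr1 => ya.
  by exists a; rewrite ?mulr1 //; exact: unitr_linv ya.
set s := \sum_(f in D) f in aD *.
have [] := orthogonal_mul_sum orthE sDE eE; rewrite (negbTE eD) -/s => es se.
have ss : s * s = s := orthogonal_sum_idem orthE sDE.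
have [w we] := faithful_on_extend ss (proj1 orthE e eE) se es aD.
have sumeD : \sum_(f in e |: D) f = s + e by rewrite big_setU1 //= addrC.
rewrite -sumeD => aw.
have [||u uu ue] := IHn (e |: D) (a * s + w) _ _ aw.
- rewrite -ltnS (leq_trans _ leDn) // ltnS proper_card //.
  apply/properP; split; first exact: setDS (subsetUr _ _).
  by exists e; rewrite !inE ?eE ?eD // eqxx.
- by apply/subsetP=> f /setU1P[->|/(subsetP sDE)].
exists u => //; rewrite sumeD in ue.
have := congr1 ( *%R^~ s) ue; rewrite -!mulrA mulrDl ss es addr0 => ->.
by rewrite mulrDl -mulrA ss -we -mulrA es mulr0 addr0.
Qed.

End UnitExtension.

(** * Counting in a well-covered semisimple ring *)

Section WellCoveredSemisimple.
Variables (S : finUnitRingType) (E : {set S}).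
Variable orthE : orthogonal_primitives E.
Variable sumE : \sum_(e in E) e = 1.
Variable wcS : well_covered (@unitary_cayley S).
Implicit Types e f x y : S.

Let primE e : e \in E -> primitive_idem e. Proof. exact: (proj1 orthE). Qed.
Let idemE e : e \in E -> e * e = e. Proof. by case/primE. Qed.
Let orth e f : e \in E -> f \in E -> e != f -> e * f = 0.
Proof. exact: (proj2 orthE). Qed.

Lemma card_preim_mulr e (D : {set S}) : e * e = e -> D \subset corner 1 e ->
  #|[set x | x * e \in D]| = (#|D| * #|[set x | (x * e)%R == 0%R]|)%N.
Proof.
move=> ee /subsetP sD.
apply: (@card_preim_additive _ _ (e \o* idfun : {additive S -> S})) => w /sD.
by case/(cornerP _ (mulr1 1) ee) => _ we; exists w.
Qed.

Lemma well_covered_card (A B : {set S}) :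
    nonunit_diff A -> unit_dominating A -> nonunit_diff B -> unit_dominating B ->
  #|A| = #|B|.
Proof.
by move=> iA dA iB dB; apply: wcS; apply/maximal_independentP.
Qed.

Lemma annihilator_independent e : e != 0 -> nonunit_diff [set x : S | x * e == 0].
Proof.
move=> e0 x y; rewrite !inE => /eqP xe /eqP ye; apply: contra e0 => u.
by rewrite -(mulKr u e) mulrBl xe ye subrr mulr0.
Qed.

(** If [x e] is nonzero, some unit [u] has [u e = x e], and [x - u] lies in the annihilator at
    distance [u] from [x]. *)
Lemma annihilator_dominating e : e \in E -> unit_dominating [set x : S | x * e == 0].
Proof.
move=> eE x; rewrite inE => /(faithful_on_primitive (primE eE)).
have s1 : \sum_(f in [set e]) f = e by rewrite big_set1.
rewrite -[X in faithful_on _ X]s1.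
case/(faithful_on_extend_unit orthE sumE); first by rewrite sub1set.
move=> u uu; rewrite s1 => ue.
by exists (x - u); rewrite ?inE ?mulrBl ?ue ?subrr // opprB addrC subrK.
Qed.

(** The order of [S] is that of [S e] times that of the annihilator of [e], and all these
    annihilators are maximal independent sets. *)
Lemma card_corner_const e f : e \in E -> f \in E -> #|corner 1 e| = #|corner 1 f|.
Proof.
have cardS g : g \in E ->
    #|S| = (#|corner 1%R g| * #|[set x | (x * g)%R == 0%R]|)%N.
  move=> gE; rewrite -card_preim_mulr ?idemE // -cardsT; apply: eq_card => x.
  by rewrite !inE mul1r -mulrA idemE ?eqxx.
move=> eE fE; have := cardS e eE; rewrite (cardS f fE).
rewrite (@well_covered_card [set x : S | x * f == 0] [set x : S | x * e == 0]).
- move/eqP; rewrite eqn_pmul2r => [/eqP //|].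
  by apply/card_gt0P; exists 0; rewrite inE mul0r.
- by apply: annihilator_independent; case: (primE fE).
- exact: annihilator_dominating.
- by apply: annihilator_independent; case: (primE eE).
- exact: annihilator_dominating.
Qed.

Let corner_iso e f : e \in E -> f \in E -> (1 < #|corner e f|)%N ->
  isomorphic_idempotents e f.
Proof.
move=> eE fE; rewrite (cardsD1 0) corner0 ltnS => /card_gt0P[u /setD1P[u0 uP]].
exact: primitive_isomorphic (primE eE) (primE fE) uP u0.
Qed.

Let leq_corners e f g : e \in E -> f \in E -> g \in E -> e != f ->
  (#|corner e g| * #|corner f g| <= #|corner 1%R g|)%N.
Proof.
move=> eE fE gE nef.
have ef := orth eE fE nef; have fe : f * e = 0 by rewrite orth // eq_sym.
rewrite -card_cornerDl ?idemE //; apply/subset_leq_card/subsetP => x.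
have hh : (e + f) * (e + f) = e + f by rewrite mulrDl !mulrDr !idemE // ef fe addr0 add0r.
move=> /(cornerP _ hh (idemE gE))[_ xg].
by apply/cornerP; rewrite ?mulr1 ?mul1r ?idemE.
Qed.

(** * Three orthogonal primitive idempotents *)

Section Triple.
Variables e1 e2 e3 : S.
Variables (e1E : e1 \in E) (e2E : e2 \in E) (e3E : e3 \in E).
Variables (e12 : e1 != e2) (e13 : e1 != e3) (e23 : e2 != e3).
Let q := #|corner 1 e1|.
Let eps := e1 + e2 + e3.

Let ee1 : e1 * e1 = e1. Proof. exact: idemE. Qed.
Let ee2 : e2 * e2 = e2. Proof. exact: idemE. Qed.
Let ee3 : e3 * e3 = e3. Proof. exact: idemE. Qed.
Let o12 : e1 * e2 = 0. Proof. exact: orth. Qed.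
Let o13 : e1 * e3 = 0. Proof. exact: orth. Qed.
Let o23 : e2 * e3 = 0. Proof. exact: orth. Qed.
Let o21 : e2 * e1 = 0. Proof. by apply: orth; rewrite // eq_sym. Qed.
Let o31 : e3 * e1 = 0. Proof. by apply: orth; rewrite // eq_sym. Qed.
Let o32 : e3 * e2 = 0. Proof. by apply: orth; rewrite // eq_sym. Qed.
Let epse1 : eps * e1 = e1. Proof. by rewrite !mulrDl ee1 o21 o31 !addr0. Qed.
Let epse2 : eps * e2 = e2. Proof. by rewrite !mulrDl ee2 o12 o32 addr0 add0r. Qed.
Let epse3 : eps * e3 = e3. Proof. by rewrite !mulrDl ee3 o13 o23 !add0r. Qed.
Let epseps : eps * eps = eps. Proof. by rewrite {2}/eps !mulrDr epse1 epse2 epse3. Qed.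

Lemma corner_gt1 e : e \in E -> (1 < #|corner 1%R e|)%N.
Proof.
move=> eE; have [e0 ee _] := primE eE; rewrite (cardsD1 0) (cardsD1 e) corner0.
by rewrite !inE e0 mul1r ee eqxx.
Qed.

Lemma leq_left_ideal_corner e x y : e \in E -> x * e = x ->
  (#|left_ideal (x * y)%R| <= q)%N.
Proof.
move=> eE xe; apply: leq_trans (leq_left_idealMr _ _) _; rewrite -xe.
apply: leq_trans (leq_left_idealM _ _) _.
by rewrite left_idealE ?idemE // (card_corner_const eE e1E).
Qed.

Lemma left_ideal_pair e f x : e \in E -> f \in E -> e != f ->
  faithful_on x (e + f) -> (q ^ 2 <= #|left_ideal x|)%N.
Proof.
move=> eE fE nef [y yx].
have ef := orth eE fE nef; have fe : f * e = 0 by rewrite orth // eq_sym.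
apply: leq_trans (leq_left_idealMr x (e + f)).
apply: leq_trans (leq_left_idealM y _); rewrite yx.
have hh : (e + f) * (e + f) = e + f by rewrite mulrDl !mulrDr !idemE // ef fe addr0 add0r.
rewrite left_idealE // card_cornerDr ?mulr1 ?idemE //.
by rewrite (card_corner_const eE e1E) (card_corner_const fE e1E).
Qed.

(** Every [S e] with [e] in [E] has [q] elements, so the bound expresses that [x * eps] has rank at
    most one. *)
Definition small_rank := [set x : S | #|left_ideal (x * eps)%R| <= q]%N.

(** If [x - y] were a unit, [S eps], of order [q ^ 3], would equal [S (x - y) eps], which has at
    most [q ^ 2] elements. *)
Lemma small_rank_independent : nonunit_diff small_rank.
Proof.
move=> x y; rewrite !inE => rx ry; apply/negP => u.
have : (q ^ 3 <= q ^ 2)%N.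
  have -> : (q ^ 3 = #|left_ideal eps|)%N.
    rewrite left_idealE // !card_cornerDr ?mulr1 ?ee1 ?ee2 ?ee3 //.
    - rewrite (card_corner_const e2E e1E) (card_corner_const e3E e1E).
      by rewrite !expnS expn0 muln1 mulnA.
    - by rewrite mulrDl !mulrDr ee1 ee2 o12 o21 addr0 add0r.
    - by rewrite mulrDl o13 o23 addr0.
    - by rewrite mulrDr o31 o32 addr0.
  rewrite -[eps](mulKr u); apply: leq_trans (leq_left_idealM _ _) _.
  rewrite mulrBl; apply: leq_trans (leq_left_idealB _ _) _.
  exact: leq_mul.
by rewrite leq_exp2l ?corner_gt1.
Qed.

(** A unit [u] agreeing with [x] on [e + f] leaves [x - u] supported, within [eps], on the single
    idempotent [g]. *)
Lemma dominating_pair e f g x : e \in E -> f \in E -> g \in E -> e != f ->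
    eps = e + f + g -> faithful_on x (e + f) ->
  exists2 a, a \in small_rank & x - a \is a GRing.unit.
Proof.
move=> eE fE gE nef epsE.
have sumef : \sum_(i in [set e; f]) i = e + f.
  by rewrite big_setU1 ?big_set1 // inE.
rewrite -[X in faithful_on _ X]sumef.
case/(faithful_on_extend_unit orthE sumE); first by rewrite subUset !sub1set eE.
move=> u uu; rewrite sumef => uef.
exists (x - u); last by rewrite opprB addrC subrK.
rewrite inE epsE mulrDr [X in X + _]mulrBl uef subrr add0r.
by rewrite -[_ * g]mulr1; apply: (leq_left_ideal_corner _ gE); rewrite -mulrA idemE.
Qed.

(** Start from the first nonzero [x e_i]. If no later [e_j] gives a faithful pair with it, the later
    columns are right multiples of [x e_i] and [x * eps] has rank at most one. *)
Lemma small_rank_dominating : unit_dominating small_rank.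
Proof.
move=> x xA; have xeps : x * eps = x * e1 + x * e2 + x * e3 by rewrite !mulrDr.
have [x1|x1] := eqVneq (x * e1) 0; last first.
  have [[h hP xh]|] := primitive_pair (primE e1E) (primE e2E) o12 o21 x1; last first.
    exact: (@dominating_pair _ _ e3).
  have [[k kP xk]|] := primitive_pair (primE e1E) (primE e3E) o13 o31 x1; last first.
    by apply: (@dominating_pair _ _ e2); rewrite // /eps addrAC.
  case/negP: xA; rewrite inE xeps xh xk -{1}ee1 mulrA -!mulrDr.
  by apply: (leq_left_ideal_corner _ e1E); rewrite -mulrA ee1.
have [x2|x2] := eqVneq (x * e2) 0; last first.
  have [[k kP xk]|] := primitive_pair (primE e2E) (primE e3E) o23 o32 x2; last first.
    by apply: (@dominating_pair _ _ e1); rewrite // /eps -addrA addrC.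
  case/negP: xA; rewrite inE xeps x1 add0r xk -{1}ee2 mulrA -!mulrDr.
  by apply: (leq_left_ideal_corner _ e2E); rewrite -mulrA ee2.
case/negP: xA; rewrite inE xeps x1 x2 !add0r -[x * e3]mulr1.
by apply: (leq_left_ideal_corner _ e3E); rewrite -mulrA ee3.
Qed.

(** The image of [small_rank] under right multiplication by [eps]. *)
Let T := [set y | (y * eps == y) && (#|left_ideal y| <= q)%N].

(** Both [small_rank] and the annihilator of [e1] are preimages under right multiplication by [eps],
    of [T] and of [S (e2 + e3)] respectively. They have equal order, and [S (e2 + e3)] has [q ^ 2]
    elements. *)
Lemma card_small_rank_image : #|T| = (q ^ 2)%N.
Proof.
pose K := #|[set x : S | x * eps == 0]|.
have K0 : (0 < K)%N by apply/card_gt0P; exists 0; rewrite inE mul0r.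
apply/eqP; rewrite -(eqn_pmul2r K0); apply/eqP.
have <- : #|small_rank| = (#|T| * K)%N.
  rewrite -card_preim_mulr //.
    by apply: eq_card => x; rewrite !inE -mulrA epseps eqxx.
  by apply/subsetP=> y /setIdP[/eqP ye _]; apply/cornerP; rewrite ?mulr1 ?mul1r.
have e230 : (e2 + e3) * e1 = 0 by rewrite mulrDl o21 o31 addr0.
have hh : (e2 + e3) * (e2 + e3) = e2 + e3.
  by rewrite mulrDl !mulrDr ee2 ee3 o23 o32 addr0 add0r.
have epsh : eps * (e2 + e3) = e2 + e3 by rewrite mulrDr epse2 epse3.
have -> : (q ^ 2 = #|corner 1%R (e2 + e3)%R|)%N.
  rewrite card_cornerDr ?mulr1 //.
  by rewrite (card_corner_const e2E e1E) (card_corner_const e3E e1E).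
rewrite -card_preim_mulr //; last first.
  apply/subsetP=> y /(cornerP _ (mulr1 1) hh)[_ yh]; apply/cornerP;
    rewrite ?mulr1 ?mul1r //.
  by split=> //; rewrite -yh -mulrA -[eps]addrA mulrDr hh mulrDl o21 o31 !addr0 add0r.
rewrite (@well_covered_card small_rank [set x : S | x * e1 == 0]).
- apply: eq_card => x; rewrite !inE mul1r -mulrA epsh.
  rewrite /eps -addrA [x * (e1 + _)]mulrDr.
  apply/eqP/eqP => [->|/esym/eqP]; first by rewrite add0r.
  by rewrite -subr_eq0 addrK => /eqP.
- exact: small_rank_independent.
- exact: small_rank_dominating.
- by apply: annihilator_independent; case: (primE e1E).
- exact: annihilator_dominating.
Qed.

(** A faithful pair would force [q ^ 2 <= q], so only the first alternative of [primitive_pair]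
    remains. *)
Let T_row e f y : y \in T -> e \in E -> f \in E -> e != f -> y * e != 0 ->
  exists2 h, h \in corner e f & y * f = y * e * h.
Proof.
case/setIdP=> _ ry eE fE nef ye.
have ef := orth eE fE nef; have fe : f * e = 0 by rewrite orth // eq_sym.
case: (primitive_pair (primE eE) (primE fE) ef fe ye) => // faith.
have := leq_trans (left_ideal_pair eE fE nef faith) ry.
by rewrite -[X in (_ <= X)%N]expn1 leq_exp2l ?corner_gt1.
Qed.

Let T1_card : #|[set y in T | y * e1 != 0]| =
  (q.-1 * (#|corner e1 e2| * #|corner e1 e3|))%N.
Proof.
pose g (p : S * (S * S)) := p.1 * (e1 + p.2.1 + p.2.2).
pose D := setX (corner 1 e1 :\ 0) (setX (corner e1 e2) (corner e1 e3)).
have gP p : p \in D -> [/\ g p * e1 = p.1, g p * e2 = p.1 * p.2.1,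
    g p * e3 = p.1 * p.2.2, p.1 != 0 & g p * eps = g p].
  case: p => a [h k] /setXP[/= /setD1P[a0 /(cornerP _ (mulr1 1) ee1)[_ ae]]].
  move=> /setXP[/= /(cornerP _ ee1 ee2)[eh he] /(cornerP _ ee1 ee3)[ek ke]].
  have h1 : h * e1 = 0 by rewrite -he -mulrA o21 mulr0.
  have h3 : h * e3 = 0 by rewrite -he -mulrA o23 mulr0.
  have k1 : k * e1 = 0 by rewrite -ke -mulrA o31 mulr0.
  have k2 : k * e2 = 0 by rewrite -ke -mulrA o32 mulr0.
  have g1 : g (a, (h, k)) * e1 = a by rewrite -mulrA !mulrDl ee1 h1 k1 !addr0.
  have g2 : g (a, (h, k)) * e2 = a * h by rewrite -mulrA !mulrDl o12 he k2 add0r addr0.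
  have g3 : g (a, (h, k)) * e3 = a * k by rewrite -mulrA !mulrDl o13 h3 ke !add0r.
  by split=> //; rewrite /eps !mulrDr g1 g2 g3 /g /= !mulrDr ae.
have -> : q.-1 = #|corner 1%R e1 :\ 0%R| by rewrite /q (cardsD1 0) corner0.
rewrite -!cardsX -(@card_in_imset _ _ g).
  apply: eq_card => y; rewrite inE; apply/andP/imsetP => [[yT y1]|[p pD ->]].
    have [h hP yh] := T_row yT e1E e2E e12 y1.
    have [k kP yk] := T_row yT e1E e3E e13 y1.
    have /setIdP[/eqP yeps _] := yT.
    exists (y * e1, (h, k)).
      apply/setXP; split; last exact/setXP.
      by apply/setD1P; split=> //; apply/cornerP; rewrite ?mulr1 ?mul1r // -mulrA ee1.
    by rewrite /g /= !mulrDr -yh -yk -mulrA ee1 -!mulrDr.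
  have [g1 _ _ p0 geps] := gP p pD; rewrite g1; split=> //.
  rewrite inE geps eqxx; apply: leq_left_ideal_corner e1E _.
  by case: p pD {g1 p0 geps} => a b /setXP[/setD1P[_ /(cornerP _ (mulr1 1) ee1)[]]].
move=> [a [h k]] [a' [h' k']] pD pD' eqg.
have [/= g1 g2 g3 a0 _] := gP _ pD; have [/= g1' g2' g3' _ _] := gP _ pD'.
have aa' : a = a' by rewrite -g1 eqg g1'.
have /setXP[/setD1P[_ /(cornerP _ (mulr1 1) ee1)[_ /= ae]] /setXP[/= hP kP]] : (a, (h, k)) \in D := pD.
have /setXP[_ /setXP[/= hP' kP']] : (a', (h', k')) \in D := pD'.
have [_ _ r1] := primE e1E; have [|t ta] := r1 a; first by rewrite ae.
rewrite ae in ta.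
(* Primitivity of [e1] gives [t] with [t a = e1], so [a] cancels on the left and the ratios are
   determined. *)
have canc f x x' : f * f = f -> x \in corner e1 f -> x' \in corner e1 f ->
    a * x = a * x' -> x = x'.
  move=> ff /(cornerP _ ee1 ff)[ex _] /(cornerP _ ee1 ff)[ex' _] /(congr1 ( *%R t)).
  by rewrite !mulrA ta ex ex'.
congr (_, (_, _)) => //.
  by apply: (canc e2) => //; rewrite -g2 eqg g2' aa'.
by apply: (canc e3) => //; rewrite -g3 eqg g3' aa'.
Qed.

Let T2_card : #|[set y in T | (y * e1 == 0) && (y * e2 != 0)]| =
  (q.-1 * #|corner e2 e3|)%N.
Proof.
pose g (p : S * S) := p.1 * (e2 + p.2).
pose D := setX (corner 1 e2 :\ 0) (corner e2 e3).
have gP p : p \in D -> [/\ g p * e1 = 0, g p * e2 = p.1,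
    g p * e3 = p.1 * p.2, p.1 != 0 & g p * eps = g p].
  case: p => a h /setXP[/= /setD1P[a0 /(cornerP _ (mulr1 1) ee2)[_ ae]]].
  move=> /(cornerP _ ee2 ee3)[eh he].
  have h1 : h * e1 = 0 by rewrite -he -mulrA o31 mulr0.
  have h2 : h * e2 = 0 by rewrite -he -mulrA o32 mulr0.
  have g1 : g (a, h) * e1 = 0 by rewrite -mulrA mulrDl o21 h1 addr0 mulr0.
  have g2 : g (a, h) * e2 = a by rewrite -mulrA mulrDl ee2 h2 addr0.
  have g3 : g (a, h) * e3 = a * h by rewrite -mulrA mulrDl o23 he add0r.
  by split=> //; rewrite /eps !mulrDr g1 g2 g3 /g /= add0r mulrDr ae.
have -> : q.-1 = #|corner 1%R e2 :\ 0%R|.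
  by rewrite /q (card_corner_const e1E e2E) (cardsD1 0) corner0.
rewrite -!cardsX -(@card_in_imset _ _ g).
  apply: eq_card => y; rewrite inE; apply/and3P/imsetP => [[yT /eqP y1 y2]|[p pD ->]].
    have [h hP yh] := T_row yT e2E e3E e23 y2.
    have /setIdP[/eqP yeps _] := yT.
    exists (y * e2, h).
      apply/setXP; split=> //.
      by apply/setD1P; split=> //; apply/cornerP; rewrite ?mulr1 ?mul1r // -mulrA ee2.
    rewrite /g /= !mulrDr -yh -mulrA ee2 -[LHS]yeps /eps !mulrDr y1 add0r.
    by [].
  have [g1 g2 _ p0 geps] := gP p pD; rewrite g1 g2; split=> //.
  rewrite inE geps eqxx; apply: leq_left_ideal_corner e2E _.
  by case: p pD {g1 g2 p0 geps} => a b /setXP[/setD1P[_ /(cornerP _ (mulr1 1) ee2)[]]].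
move=> [a h] [a' h'] pD pD' eqg.
have [/= _ g2 g3 a0 _] := gP _ pD; have [/= _ g2' g3' _ _] := gP _ pD'.
have aa' : a = a' by rewrite -g2 eqg g2'.
have /setXP[/setD1P[_ /(cornerP _ (mulr1 1) ee2)[_ /= ae]] /= hP] : (a, h) \in D := pD.
have /setXP[_ /= hP'] : (a', h') \in D := pD'.
have [_ _ r2] := primE e2E; have [|t ta] := r2 a; first by rewrite ae.
rewrite ae in ta; congr (_, _) => //.
have /(cornerP _ ee2 ee3)[eh _] := hP; have /(cornerP _ ee2 ee3)[eh' _] := hP'.
by rewrite -eh -eh' -ta -!mulrA -g3 eqg g3' aa'.
Qed.

Let T3_card : #|[set y in T | (y * e1 == 0) && (y * e2 == 0)]| = q.
Proof.
rewrite /q (card_corner_const e1E e3E); apply: eq_card => y.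
rewrite !inE mul1r; apply/and3P/eqP => [[/andP[/eqP yeps _] /eqP y1 /eqP y2]|y3].
  by rewrite -[RHS]yeps /eps !mulrDr y1 y2 !add0r.
have y1 : y * e1 = 0 by rewrite -y3 -mulrA o31 mulr0.
have y2 : y * e2 = 0 by rewrite -y3 -mulrA o32 mulr0.
rewrite y1 y2 eqxx /eps !mulrDr y1 y2 y3 !add0r eqxx; split=> //=.
by rewrite -[y]mulr1; exact: leq_left_ideal_corner e3E y3.
Qed.

(* Splits [T] according to the first [e_i] with [y * e_i != 0]: from there on
   the rank-one element [y] is determined by [y * e_i] and the ratios in
   [corner e_i e_j]. *)
Lemma corner_cards_eq :
  (#|corner e1 e2| * #|corner e1 e3| + #|corner e2 e3| = q)%N.
Proof.
have := card_small_rank_image.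
rewrite -(cardsID [set y | y * e1 == 0] T) -(cardsID [set y | y * e2 == 0] (T :&: _)).
have -> : T :&: [set y | y * e1 == 0] :&: [set y | y * e2 == 0] =
          [set y in T | (y * e1 == 0) && (y * e2 == 0)].
  by apply/setP=> y; rewrite !in_setI !in_set; case: (y \in T); rewrite // ?andbA.
have -> : T :&: [set y | y * e1 == 0] :\: [set y | y * e2 == 0] =
          [set y in T | (y * e1 == 0) && (y * e2 != 0)].
  by apply/setP=> y; rewrite !inE andbC -!andbA.
have -> : T :\: [set y | y * e1 == 0] = [set y in T | y * e1 != 0].
  by apply/setP=> y; rewrite !inE andbC.
rewrite T1_card T2_card T3_card.
(* With [hij] the order of [corner ei ej], the count reads [(q - 1) h12 h13 + (q - 1) h23 + q = q ^
   2]; a factor [q - 1] cancels. *)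
move: (corner_gt1 e1E); rewrite -/q; case: (q) => // n; rewrite ltnS => n0 /= eqn.
apply/eqP; rewrite -(eqn_pmul2l n0); apply/eqP.
rewrite mulnDr; move: eqn; rewrite expnS expn1 mulSn mulnS.
set X := (n * (_ * _))%N; set Y := (n * #|_|)%N; lia.
Qed.

(** If all three corners are trivial, the equation gives [q = 2]. If exactly one has order [c > 1],
    then [q = c + 1] contradicts [c ^ 2 <= q]; exactly two is impossible since isomorphism is
    transitive; if all three are nontrivial, [q = c ^ 2 + c] contradicts [c ^ 3 <= q]. *)
Lemma triple_card2 : q = 2.
Proof.
have cgt0 e f : (#|corner e f| = 1 \/ 1 < #|corner e f|)%N.
  by have := card_corner_gt0 e f; case: #|_| => [|[|n]] // _; [left|right].
have isol e f g : e \in E -> f \in E -> g \in E -> (1 < #|corner e f|)%N ->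
    #|corner e g| = #|corner f g|.
  by move=> eE fE gE /(corner_iso eE fE); apply: isomorphic_card_cornerl; exact: idemE.
have isor e f g : e \in E -> f \in E -> g \in E -> (1 < #|corner e f|)%N ->
    #|corner g e| = #|corner g f|.
  by move=> eE fE gE /(corner_iso eE fE); apply: isomorphic_card_cornerr; exact: idemE.
have := corner_cards_eq.
have [h12|h12] := cgt0 e1 e2; have [h13|h13] := cgt0 e1 e3;
  have [h23|h23] := cgt0 e2 e3.
- by rewrite h12 h13 h23.
- have := leq_corners e2E e3E e2E e23; rewrite -(card_corner_const e1E e2E) -/q.
  rewrite -(isol _ _ _ e2E e3E e2E h23) (isor _ _ _ e2E e3E e2E h23) h12 h13.
  by move: h23; set c := #|_|; move: (q) => n; nia.
- have := leq_corners e1E e3E e1E e13; rewrite -/q.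
  rewrite -(isol _ _ _ e1E e3E e1E h13) (isor _ _ _ e1E e3E e1E h13) h12 h23.
  by move: h13; set c := #|_|; move: (q) => n; nia.
- by have := isor _ _ _ e2E e3E e1E h23; rewrite h12 => h; rewrite -h in h13.
- have := leq_corners e1E e2E e1E e12; rewrite -/q.
  rewrite -(isol _ _ _ e1E e2E e1E h12) (isor _ _ _ e1E e2E e1E h12) h13 h23.
  by move: h12; set c := #|_|; move: (q) => n; nia.
- by have := isol _ _ _ e1E e2E e3E h12; rewrite h13 => h; rewrite -h in h23.
- by have := isol _ _ _ e1E e2E e3E h12; rewrite h23 => h; rewrite h in h13.
have : (#|corner eps e1| <= q)%N.
  apply/subset_leq_card/subsetP => x /(cornerP _ epseps ee1)[_ xe].
  by apply/cornerP; rewrite ?mulr1 ?mul1r.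
have ee12 : (e1 + e2) * (e1 + e2) = e1 + e2.
  by rewrite mulrDl !mulrDr ee1 ee2 o12 o21 addr0 add0r.
have o123 : (e1 + e2) * e3 = 0 by rewrite mulrDl o13 o23 addr0.
have o312 : e3 * (e1 + e2) = 0 by rewrite mulrDr o31 o32 addr0.
rewrite !card_cornerDl //.
rewrite -(isol _ _ _ e1E e2E e1E h12) -(isol _ _ _ e1E e3E e1E h13).
rewrite -(isol _ _ _ e1E e2E e3E h12) -(isor _ _ _ e1E e2E e1E h12).
rewrite -(isor _ _ _ e1E e3E e1E h13).
have := h12; rewrite -(isor _ _ _ e1E e2E e1E h12).
by set c := #|_|; move: (q) => n; nia.
Qed.

End Triple.
End WellCoveredSemisimple.

(** * Identification of the ring *)

Lemma ring_isomorphic_intro (A B : pzRingType) (f : A -> B) :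
    {morph f : x y / x - y} -> {morph f : x y / x * y} -> f 1 = 1 -> bijective f ->
  ring_isomorphic A B.
Proof.
move=> fB fM f1 bij.
pose fz := GRing.isZmodMorphism.Build A B f fB.
pose fm := GRing.isMonoidMorphism.Build A B f (f1, fM).
by exists (HB.pack f fz fm : {rmorphism A -> B}).
Qed.

Lemma card_nonzero2 (T : finZmodType) (A : {set T}) x :
  #|A| = 2 -> 0 \in A -> x \in A -> x != 0 -> A = [set 0; x].
Proof.
move=> A2 A0 Ax x0; apply/esym/eqP; rewrite eqEcard A2 cards2 eq_sym x0 leqnn andbT.
by apply/subsetP=> y /set2P[] ->.
Qed.

Section Structure.
Variables (S : finUnitRingType) (E : {set S}).
Variable orthE : orthogonal_primitives E.
Variable sumE : \sum_(e in E) e = 1.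
Implicit Types e f x y : S.

Let primE e : e \in E -> primitive_idem e. Proof. exact: (proj1 orthE). Qed.
Let idemE e : e \in E -> e * e = e. Proof. by case/primE. Qed.
Let orth e f : e \in E -> f \in E -> e != f -> e * f = 0.
Proof. exact: (proj2 orthE). Qed.

(** Each [S e] is [{0, e}], so [x] is determined by recording which products [x * e] are nonzero. *)
Lemma card2_ring_isomorphic : {in E, forall e, #|corner 1 e| = 2} ->
  ring_isomorphic S {ffun 'I_#|E| -> 'Z_2}.
Proof.
move=> card2.
have mem2 e x : e \in E -> x * e = 0 \/ x * e = e.
  move=> eE; have [e0 ee _] := primE eE.
  have /set2P : x * e \in [set 0; e]; last by [].
  rewrite -(card_nonzero2 (card2 e eE)) ?corner0 //.
  - by apply/cornerP; rewrite ?mulr1 ?mul1r // -mulrA ee.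
  - by apply/cornerP; rewrite ?mulr1 ?mul1r.
have double e : e \in E -> e + e = 0.
  move=> eE; have [e0 ee _] := primE eE.
  case: (mem2 e (1 + 1) eE) => [|/eqP]; first by rewrite mulrDl !mul1r.
  by rewrite mulrDl !mul1r -subr_eq0 addrK (negbTE e0).
pose ev (i : 'I_#|E|) : S := enum_val i.
have val i : ev i \in E by exact: enum_valP.
pose nz (x : S) := x != 0.
have nz0 : nz 0 = false by rewrite /nz eqxx.
have nze i : nz (ev i) by case: (primE (val i)).
pose g x := [ffun i : 'I_#|E| => (nz (x * ev i))%:R : 'Z_2].
apply: (@ring_isomorphic_intro _ _ g).
- move=> x y; apply/ffunP=> i; rewrite !ffunE mulrBl.
  case: (mem2 _ x (val i)) => ->; case: (mem2 _ y (val i)) => ->.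
  + by rewrite !subrr nz0.
  + by rewrite nz0 nze /nz sub0r oppr_eq0 -/(nz _) nze; apply: val_inj.
  + by rewrite subr0 nze nz0 subr0.
  + by rewrite !subrr nz0.
- move=> x y; apply/ffunP=> i; rewrite !ffunE -mulrA.
  case: (mem2 _ y (val i)) => ->; first by rewrite !mulr0 nz0 mulr0.
  by rewrite nze mulr1.
- by apply/ffunP=> i; rewrite !ffunE mul1r nze.
have inj : injective g.
  move=> x y /ffunP gxy; rewrite -[x]mulr1 -[y]mulr1 -sumE !mulr_sumr.
  apply: eq_bigr => e eE; have e0 : nz e by case: (primE eE).
  have := gxy (enum_rank_in eE e); rewrite !ffunE /ev enum_rankK_in //.
  by case: (mem2 e x eE) => ->; case: (mem2 e y eE) => ->; rewrite ?nz0 ?e0.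
pose h (c : {ffun 'I_#|E| -> 'Z_2}) := \sum_i (if c i != 0 then ev i else 0).
have hK : cancel h g.
  move=> c; apply/ffunP=> j;
    rewrite ffunE mulr_suml (bigD1 j) //= big1 ?addr0 => [|i ij].
    case: ifP => [cj|/negbFE/eqP->].
      rewrite idemE // nze; move: cj; case: (c j) => [[|[|m]] // ltm] _; exact: val_inj.
    by rewrite mul0r nz0.
  case: ifP => _; last by rewrite mul0r.
  by rewrite orth ?val // (inj_eq enum_val_inj).
by exists h => // x; apply: inj; rewrite hK.
Qed.

(** The only idempotent in [E] is 1, so nonzero elements have left inverses; Wedderburn's theorem
    makes the finite domain a field. *)
Lemma card1_field : #|E| = 1 -> exists F : finFieldType, ring_isomorphic S F.
Proof.
case/eqP/cards1P => e Ee; have [_ _ pe] : primitive_idem e by apply: primE;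
  rewrite Ee set11.
move: sumE pe; rewrite Ee big_set1 => -> p1.
have dom : GRing.integral_domain_axiom S.
  move=> x y /eqP; apply: contraLR; rewrite negb_or => /andP[x0 y0].
  have [|x' x'x] := p1 x; first by rewrite mulr1.
  apply/eqP => xy0; case/eqP: y0.
  by rewrite -[y]mul1r -x'x mulr1 -mulrA xy0 mulr0.
exists (FinDomainFieldType dom).
by apply: (@ring_isomorphic_intro S (FinDomainFieldType dom) id) => //; exists id.
Qed.

End Structure.

(** The ring [e S e] with identity [e]. The proofs [ee] and [e0] are parameters of the type so that
    its ring structure can be declared as an instance. *)
Record corner_ring (S : finUnitRingType) (e : S) (ee : e * e = e) (e0 : e != 0) :=
  CornerRing { corner_val : S; _ : corner_val \in corner e e }.

Section CornerRing.
Variables (S : finUnitRingType) (e : S) (ee : e * e = e) (e0 : e != 0).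
Local Notation C := (corner_ring ee e0).

HB.instance Definition _ := [isSub for @corner_val S e ee e0].
HB.instance Definition _ := [Finite of C by <:].

Let cP x := cornerP x ee ee.
Let CP (a : C) : e * val a = val a /\ val a * e = val a.
Proof. exact/cP/valP. Qed.

Let zero_proof : 0 \in corner e e. Proof. exact: corner0. Qed.
Let one_proof : e \in corner e e. Proof. exact/cP. Qed.
Let opp_proof (a : C) : - val a \in corner e e.
Proof. by have [ea ae] := CP a; apply/cP; rewrite mulrN mulNr ea ae. Qed.
Let add_proof (a b : C) : val a + val b \in corner e e.
Proof.
by have [ea ae] := CP a; have [eb be] := CP b; apply/cP;
  rewrite mulrDr mulrDl ea ae eb be.
Qed.
Let mul_proof (a b : C) : val a * val b \in corner e e.
Proof.
by have [ea ae] := CP a; have [eb be] := CP b; apply/cP; rewrite mulrA ea -mulrA be.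
Qed.

Definition corner_zero : C := CornerRing ee e0 zero_proof.
Definition corner_one : C := CornerRing ee e0 one_proof.
Definition corner_opp (a : C) : C := CornerRing ee e0 (opp_proof a).
Definition corner_add (a b : C) : C := CornerRing ee e0 (add_proof a b).
Definition corner_mul (a b : C) : C := CornerRing ee e0 (mul_proof a b).

Fact corner_addA : associative corner_add.
Proof. by move=> a b c; apply: val_inj; rewrite /= addrA. Qed.
Fact corner_addC : commutative corner_add.
Proof. by move=> a b; apply: val_inj; rewrite /= addrC. Qed.
Fact corner_add0 : left_id corner_zero corner_add.
Proof. by move=> a; apply: val_inj; rewrite /= add0r. Qed.
Fact corner_addN : left_inverse corner_zero corner_opp corner_add.
Proof. by move=> a; apply: val_inj; rewrite /= addNr. Qed.
HB.instance Definition _ :=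
  GRing.isZmodule.Build C corner_addA corner_addC corner_add0 corner_addN.

Fact corner_mulA : associative corner_mul.
Proof. by move=> a b c; apply: val_inj; rewrite /= mulrA. Qed.
Fact corner_mul1 : left_id corner_one corner_mul.
Proof. by move=> a; apply: val_inj; case: (CP a). Qed.
Fact corner_mulr1 : right_id corner_one corner_mul.
Proof. by move=> a; apply: val_inj; case: (CP a). Qed.
Fact corner_mulDl : left_distributive corner_mul +%R.
Proof. by move=> a b c; apply: val_inj; rewrite /= mulrDl. Qed.
Fact corner_mulDr : right_distributive corner_mul +%R.
Proof. by move=> a b c; apply: val_inj; rewrite /= mulrDr. Qed.
Fact corner_one_neq0 : corner_one != 0.
Proof. by apply: contra e0 => /eqP/(congr1 val)/= ->. Qed.
HB.instance Definition _ := GRing.Zmodule_isNzRing.Build C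
  corner_mulA corner_mul1 corner_mulr1 corner_mulDl corner_mulDr corner_one_neq0.
HB.instance Definition _ := FinRing.isNzRing.Build C.

End CornerRing.

(** Primitivity leaves no zero divisors in [e S e], and Wedderburn's theorem applies. [i] is the
    inclusion and [p] the compression [x |-> e x e]. *)
Lemma corner_field (S : finUnitRingType) (e : S) : primitive_idem e ->
  exists (F : finFieldType) (i : F -> S) (p : S -> F),
    [/\ {morph i : a b / a - b}, {morph i : a b / a * b}, i 1 = e,
        forall x, i (p x) = e * x * e & cancel i p].
Proof.
case=> e0 ee pe; pose C := corner_ring ee e0.
have key c x y : e * y = y -> c * (x * e) = e -> x * e = x -> x * y = 0 -> y = 0.
  by move=> ey cx xe xy; rewrite -ey -cx xe -mulrA xy mulr0.
have dom : GRing.integral_domain_axiom C.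
  move=> a b /eqP; apply: contraLR; rewrite negb_or => /andP[a0 b0].
  have /(cornerP _ ee ee)[ea ae] := valP a; have /(cornerP _ ee ee)[eb be] := valP b.
  have [|c ca] := pe (val a); first by rewrite ae -(inj_eq val_inj) in a0 *.
  apply: contra b0 => /eqP/(congr1 val)/= ab0; rewrite -(inj_eq val_inj) /=.
  apply/eqP; apply: key eb ca ae ab0.
pose p x : C := CornerRing ee e0 (mem_corner x ee ee).
exists (FinDomainFieldType dom), (fun a : C => val a), p; split=> //.
move=> a; apply: val_inj => /=; have /(cornerP _ ee ee)[ea ae] := valP a.
by rewrite ea ae.
Qed.

(** * Finite fields of the same order are isomorphic *)

Section FiniteFieldUniqueness.
Variables (k F K : finFieldType).
Variables (j1 : {rmorphism k -> F}) (j2 : {rmorphism k -> K}).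
Variable cardFK : #|F| = #|K|.

Lemma finField_generator (L : finFieldType) :
  exists z : L, forall x, x != 0 -> exists n, x = z ^+ n.
Proof.
have /cyclicP[z Uz] := field_unit_group_cyclic [set: {unit L}]%G.
exists (val z) => x x0.
have : finField_unit x0 \in <[z]>%g by rewrite -Uz inE.
by case/cycleP=> n /(congr1 val)/=; rewrite FinRing.val_unitX => xz; exists n.
Qed.

(** A nonzero polynomial of least size vanishing at [z], with ['X^#|F| - 'X] for existence; it
    divides the others by Euclidean division. Coefficient tuples make the search for the least size
    decidable. *)
Lemma finField_minimal_poly (z : F) : exists2 m : {poly k},
  (1 < size m)%N & forall p, root (map_poly j1 p) z -> m %| p.
Proof.
pose P n := [exists t : n.-tuple k,
               (Poly t != 0) && root (map_poly j1 (Poly t)) z].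
have PP (p : {poly k}) : p != 0 -> root (map_poly j1 p) z -> P (size p).
  by move=> p0 pz; apply/existsP; exists (in_tuple p); rewrite /= polyseqK p0.
have exP : exists n, P n.
  exists (size ('X^#|F| - 'X : {poly k})); apply: PP.
    rewrite -size_poly_gt0 size_polyDl ?size_polyXn // size_polyN size_polyX ltnS.
    exact: finNzRing_gt1.
  by rewrite rmorphB /= map_polyXn map_polyX finField_genPoly root_prod_XsubC mem_index_enum.
case: (ex_minnP exP) => n /existsP[t /andP[m0 mz]] minn; exists (Poly t).
  rewrite ltnNge; apply/negP => /size1_polyC mC; move: m0 mz.
  rewrite mC map_polyC rootC polyC_eq0 fmorph_eq0 => c0.
  by rewrite (negbTE c0).
move=> p pz; rewrite /dvdp; apply: contraT => r0.
have rz : root (map_poly j1 (p %% Poly t)) z.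
  move: pz; rewrite {1}(divp_eq p (Poly t)) rmorphD rmorphM /= !rootE.
  by rewrite hornerD hornerM (rootP mz) mulr0 add0r.
have := minn _ (PP _ r0 rz); rewrite leqNgt => /negP[].
apply: leq_trans (_ : (size (Poly t) <= n)%N); first by rewrite ltn_modp.
by rewrite (leq_trans (size_Poly _)) ?size_tuple.
Qed.

(** The minimal polynomial [m] of a generator [z] divides ['X^#|F| - 'X], which also splits in [K],
    so [m] has a root [z'] there. Sending [z] to [z'] is a ring morphism between fields of equal
    order. *)
Lemma finField_ring_isomorphic_over : ring_isomorphic F K.
Proof.
have [z zgen] := finField_generator F.
have [m m_gt1 mdvd] := finField_minimal_poly z.
have [z' mz'] : exists z', root (map_poly j2 m) z'.
  have : map_poly j2 m %| \prod_(y : K) ('X - y%:P).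
    rewrite -finField_genPoly -cardFK -(map_polyXn j2).
    rewrite -[X in _ - X](map_polyX j2) -rmorphB.
    rewrite dvdp_map; apply: mdvd.
    by rewrite rmorphB /= map_polyXn map_polyX finField_genPoly root_prod_XsubC mem_index_enum.
  case/dvdp_prod_XsubC => s eqp; have := eqp_size eqp.
  rewrite size_map_poly size_prod_XsubC => ms.
  move: eqp ms; case: (mask _ _) => [|y r] eqp ms; first by rewrite ms in m_gt1.
  by exists y; rewrite (eqp_root eqp) root_prod_XsubC mem_head.
have repr_ex x : exists p : {poly k}, (map_poly j1 p).[z] == x.
  have [->|/zgen[n ->]] := eqVneq x 0; first by exists 0; rewrite rmorph0 horner0.
  by exists 'X^n; rewrite map_polyXn hornerXn.
pose phi x := (map_poly j2 (xchoose (repr_ex x))).[z'].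
(* The value does not depend on the chosen polynomial: two choices differ by a multiple of [m],
   which vanishes at [z']. *)
have phiE p : phi (map_poly j1 p).[z] = (map_poly j2 p).[z'].
  have /eqP := xchooseP (repr_ex (map_poly j1 p).[z]).
  rewrite /phi; move: (xchoose _) => r rz; apply/eqP; rewrite -subr_eq0.
  rewrite -hornerN -hornerD -rmorphB /=.
  have /dvdpP[d ->] : m %| r - p by apply: mdvd;
    rewrite rootE rmorphB !hornerE rz subrr.
  by rewrite rmorphM hornerM /= (eqP mz') mulr0.
have reprE x : exists p, x = (map_poly j1 p).[z].
  by have [p /eqP] := repr_ex x; exists p.
have phiB : {morph phi : x y / x - y}.
  move=> x y; have [p ->] := reprE x; have [r ->] := reprE y.
  by rewrite -hornerN -hornerD -rmorphB !phiE rmorphB !hornerE.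
have phiM : {morph phi : x y / x * y}.
  move=> x y; have [p ->] := reprE x; have [r ->] := reprE y.
  by rewrite -hornerM -rmorphM !phiE rmorphM hornerM.
have phi1 : phi 1 = 1.
  have -> : 1 = (map_poly j1 1).[z] by rewrite rmorph1 hornerC.
  by rewrite phiE rmorph1 hornerC.
apply: (ring_isomorphic_intro phiB phiM phi1); apply: inj_card_bij;
  last by rewrite cardFK.
move=> x y /eqP; rewrite -subr_eq0 -phiB => /eqP xy0; apply/eqP; rewrite -subr_eq0.
apply: contraT => xy; have := phi1; rewrite -(divff xy) phiM xy0 mul0r.
by move/esym/eqP; rewrite oner_eq0.
Qed.

End FiniteFieldUniqueness.

Lemma prime_field_embedding (F : finFieldType) p : p \in [pchar F] ->
  {rmorphism 'F_p -> F}.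
Proof.
move=> c; pose a := GRing.in_alg (pPrimeCharType c).
pose fz := GRing.isZmodMorphism.Build 'F_p F a (rmorphB a).
pose fm := GRing.isMonoidMorphism.Build 'F_p F a (rmorph1 a, rmorphM a).
exact: (HB.pack_for {rmorphism 'F_p -> F} (a : 'F_p -> F) fz fm).
Qed.

Lemma finField_ring_isomorphic (F K : finFieldType) :
  #|F| = #|K| -> ring_isomorphic F K.
Proof.
move=> cardFK; have [p p_pr pF] := finPcharP F.
have pK : p \in [pchar K].
  by apply: (@card_finPcharP K p (logn p #|F|)) => //; rewrite -cardFK;
    exact: (card_pprimeChar pF).
have j1 := prime_field_embedding pF; have j2 := prime_field_embedding pK.
exact: finField_ring_isomorphic_over j1 j2 cardFK.
Qed.

(** * Rings with two orthogonal primitive idempotents *)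

Section TwoIdempotents.
Variables (S : finUnitRingType) (e1 e2 : S).
Variables (prim1 : primitive_idem e1) (prim2 : primitive_idem e2).
Variables (o12 : e1 * e2 = 0) (o21 : e2 * e1 = 0) (sum12 : e1 + e2 = 1).

Let ee1 : e1 * e1 = e1. Proof. by case: prim1. Qed.
Let ee2 : e2 * e2 = e2. Proof. by case: prim2. Qed.

(** [F] is the corner [e1 S e1]; multiplication by [u] and [v] carries all four Peirce components
    into it, and they become the matrix entries. *)
Lemma isomorphic_pair_mx2 : isomorphic_idempotents e1 e2 ->
  exists F : finFieldType, ring_isomorphic S 'M[F]_2.
Proof.
case=> u [v [/(cornerP _ ee1 ee2)[e1u ue2] /(cornerP _ ee2 ee1)[e2v ve1] uv vu]].
have [F [i [p [iB iM i1 ip pi]]]] := corner_field prim1; exists F.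
pose ia : {additive F -> S} := HB.pack_for {additive F -> S} i
  (GRing.isZmodMorphism.Build F S i iB).
have inj_i : injective i := can_inj pi.
have iR a : e1 * i a * e1 = i a by rewrite -ip pi.
have ile a : e1 * i a = i a by rewrite -iR !mulrA ee1.
have ire a : i a * e1 = i a by rewrite -iR -!mulrA ee1.
(* [b k * a l] are matrix units of [S], with [a k * b l] a Kronecker delta. *)
pose a (k : 'I_2) := if k == 0 then e1 else u.
pose b (k : 'I_2) := if k == 0 then e1 else v.
have sum2 (f : 'I_2 -> S) : \sum_k f k = f 0 + f 1.
  by rewrite !big_ord_recl big_ord0 addr0; congr (_ + f _); apply: val_inj.
have e1a k : e1 * a k = a k by rewrite /a; case: ifP.
have be1 k : b k * e1 = b k by rewrite /b; case: ifP.
have ba : \sum_k b k * a k = 1 by rewrite sum2 /a /b /= ee1 vu.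
have u1 : u * e1 = 0 by rewrite -ue2 -mulrA o21 mulr0.
have v1 : e1 * v = 0 by rewrite -e2v mulrA o12 mul0r.
have ab k l : a k * b l = if k == l then e1 else 0.
  rewrite /a /b.
  by case: (ord2_cases k) => ->; case: (ord2_cases l) => -> /=.
pose g x := \matrix_(k, l) p (a k * x * b l).
have ig x k l : i (g x k l) = a k * x * b l.
  by rewrite mxE ip !mulrA e1a -!mulrA be1.
pose h (M : 'M[F]_2) := \sum_k \sum_l b k * i (M k l) * a l.
have gh : cancel g h.
  move=> x; rewrite /h -[RHS]mul1r -[RHS]mulr1 -ba mulr_sumr;
    under [RHS]eq_bigr do rewrite 2!mulr_suml.
  rewrite exchange_big /=; apply: eq_bigr => l _; apply: eq_bigr => k _.
  by rewrite ig !mulrA.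
have hg : cancel h g.
  move=> M; apply/matrixP=> k l; apply: inj_i; rewrite ig /h.
  rewrite mulr_sumr mulr_suml (bigD1 k) //=.
  rewrite [X in _ + X]big1 ?addr0 => [|k' k'k]; last first.
    rewrite mulr_sumr mulr_suml big1 // => l' _.
    by rewrite !mulrA ab eq_sym (negbTE k'k) !mul0r.
  rewrite mulr_sumr mulr_suml (bigD1 l) //= [X in _ + X]big1 ?addr0 => [|l' l'l].
    by rewrite !mulrA ab eqxx ile -mulrA ab eqxx ire.
  by rewrite -!mulrA ab (negbTE l'l) !mulr0.
apply: (@ring_isomorphic_intro _ _ g); last by exists h.
- move=> x y; apply/matrixP=> k l; apply: inj_i.
  have -> : (g x - g y) k l = g x k l - g y k l by rewrite !mxE.
  by rewrite iB !ig mulrBr mulrBl.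
- move=> x y; apply/matrixP=> k l; apply: inj_i; rewrite ig mxE.
  rewrite -[i _]/(ia _) raddf_sum /=; under eq_bigr do rewrite iM !ig.
  rewrite -{1}[x]mulr1 -ba !(mulr_sumr, mulr_suml); apply: eq_bigr => m _.
  by rewrite !mulrA.
- apply/matrixP=> k l; apply: inj_i; rewrite ig mulr1 ab mxE.
  by case: (k == l) => //=; rewrite ?i1 // -[i _]/(ia _) raddf0.
Qed.

(** With no mixed Peirce components, [S e1] and [S e2] are the two corner fields, and their equal
    orders make them isomorphic. *)
Lemma disjoint_pair_prod : #|corner 1 e1| = #|corner 1 e2| ->
    (forall x, e1 * x * e2 = 0) -> (forall x, e2 * x * e1 = 0) ->
  exists F : finFieldType, ring_isomorphic S (F * F)%type.
Proof.
move=> card12 c12 c21.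
have [F [i [p [iB iM i1 ip pi]]]] := corner_field prim1.
have [K [j [r [jB jM j1 jr rj]]]] := corner_field prim2.
have inj_i : injective i := can_inj pi.
have inj_j : injective j := can_inj rj.
have x1 x : e1 * x * e1 = x * e1.
  by rewrite -[RHS]mul1r -sum12 mulrDl [X in _ + X]mulrA c21 addr0 mulrA.
have x2 x : e2 * x * e2 = x * e2.
  by rewrite -[RHS]mul1r -sum12 mulrDl [X in X + _]mulrA c12 add0r mulrA.
have cardKF : #|K| = #|F|.
  rewrite -(card_imset _ inj_i) -(card_imset _ inj_j).
  transitivity #|corner 1 e2|.
    apply: eq_card => x; apply/imsetP/(cornerP _ (mulr1 1) ee2).
      by case=> a _ ->; rewrite mul1r -[a]rj jr; split; rewrite // -!mulrA ee2.
    by case=> _ xe; exists (r x); rewrite // jr x2 xe.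
  rewrite -card12; apply/esym/eq_card => x; apply/imsetP/(cornerP _ (mulr1 1) ee1).
    by case=> a _ ->; rewrite mul1r -[a]pi ip; split; rewrite // -!mulrA ee1.
  by case=> _ xe; exists (p x); rewrite // ip x1 xe.
have [f [f' ff' f'f]] := finField_ring_isomorphic cardKF.
have x12 x : x = x * e1 + x * e2 by rewrite -mulrDr sum12 mulr1.
exists F; apply: (@ring_isomorphic_intro _ _ (fun x => (p x, f (r x)))).
- move=> x y; congr (_, _); first by apply: inj_i; rewrite iB !ip mulrBr mulrBl.
  by rewrite -[X in _ = X](rmorphB f); congr (f _); apply: inj_j;
    rewrite jB !jr mulrBr mulrBl.
- move=> x y; congr (_, _).
    by apply: inj_i; rewrite iM !ip !x1 -[RHS]mulrA [e1 * _]mulrA x1 mulrA.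
  rewrite -[X in _ = X](rmorphM f); congr (f _); apply: inj_j.
  by rewrite jM !jr !x2 -[RHS]mulrA [e2 * _]mulrA x2 mulrA.
- congr (_, _); first by apply: inj_i; rewrite ip i1 mulr1 ee1.
  rewrite -[X in _ = X](rmorph1 f); congr (f _); apply: inj_j.
  by rewrite jr j1 mulr1 ee2.
exists (fun c => i c.1 + j (f' c.2)) => [x|[c d]] /=.
  by rewrite ff' ip jr x1 x2 -x12.
have iR a : e1 * i a * e1 = i a by rewrite -ip pi.
have jR a : e2 * j a * e2 = j a by rewrite -jr rj.
congr (_, _).
  apply: inj_i; rewrite ip mulrDr mulrDl iR -[j _]jR.
  by rewrite !mulrA o12 !mul0r addr0.
rewrite -[RHS]f'f; congr (f _); apply: inj_j; rewrite jr mulrDr mulrDl jR -[i _]iR.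
by rewrite !mulrA o21 !mul0r add0r.
Qed.

Lemma pair_ring_isomorphic : #|corner 1 e1| = #|corner 1 e2| ->
  exists F : finFieldType,
    ring_isomorphic S (F * F)%type \/ ring_isomorphic S 'M[F]_2.
Proof.
move=> card12.
have [u /andP[uP u0]|no12] := pickP [pred u | (u \in corner e1 e2) && (u != 0)].
  have [F isoF] := isomorphic_pair_mx2 (primitive_isomorphic prim1 prim2 uP u0).
  by exists F; right.
have c12 x : e1 * x * e2 = 0.
  by have := no12 (e1 * x * e2); rewrite /= mem_corner // => /negbFE/eqP.
have [|F isoF] := disjoint_pair_prod card12 c12; last by exists F; left.
(* A nonzero element of [e2 S e1] would yield an isomorphism whose inverse part lies in [e1 S e2],
   already known to be 0. *)
move=> x; apply/eqP; apply: contraT => x0.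
have [w [v [_ /(cornerP _ ee1 ee2)[e1v ve2] wv _]]] :=
  primitive_isomorphic prim2 prim1 (mem_corner x ee2 ee1) x0.
by case: prim2 => /eqP[]; rewrite -wv -e1v -ve2 mulrA c12 mulr0.
Qed.

End TwoIdempotents.

(** * The theorem *)

(** Preimages of maximal independent sets are again maximal independent, and their orders are
    multiplied by that of the kernel. *)
Lemma well_covered_image (R S : finUnitRingType) (f : {rmorphism R -> S}) :
    (forall s, exists r, f r = s) ->
    (forall x, (x \is a GRing.unit) = (f x \is a GRing.unit)) ->
  well_covered (@unitary_cayley R) -> well_covered (@unitary_cayley S).
Proof.
move=> surj uf wcR.
have pre (A : {set S}) : maxset (independent (@unitary_cayley S)) A ->
    maxset (independent (@unitary_cayley R)) [set x | f x \in A].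
  move=> /maximal_independentP[indA domA]; apply/maximal_independentP; split.
    by move=> x y; rewrite !inE uf rmorphB; exact: indA.
  move=> x; rewrite inE => /domA[a aA]; have [r fr] := surj a.
  by exists r; rewrite ?inE ?fr // uf rmorphB fr.
move=> A B maxA maxB; have := wcR _ _ (pre A maxA) (pre B maxB).
rewrite !card_preim_additive; try by move=> w _; exact: surj.
move/eqP; rewrite eqn_pmul2r => [/eqP //|].
by apply/card_gt0P; exists 0; rewrite inE raddf0.
Qed.

(** * The quotient by the Jacobson radical *)

Section JacobsonQuotient.
Variable R : finUnitRingType.

HB.instance Definition _ :=
  Countable.copy (jacobson_quot R) (can_type (@reprK _ (jacobson_quot R))).
HB.instance Definition _ := isFinite.Build (jacobson_quot R)
  (pcan_enumP (can_pcan (@reprK _ (jacobson_quot R)))).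
HB.instance Definition _ := FinRing.isNzRing.Build (jacobson_quot R).

Lemma jacobson_quot_well_covered :
  well_covered (@unitary_cayley R) -> well_covered (@unitary_cayley (jacobson_quot R)).
Proof.
have [|f [surj uf]] := @jacobson_quot_iso_reflect_unit R (jacobson_quot R).
  by exists idfun; exists id.
apply: (@well_covered_image R (jacobson_quot R) f surj) => x.
apply/idP/idP => [/uf[y] | ufx]; first exact: unitr_linv.
by apply/uf; exists (f x)^-1; rewrite mulVr.
Qed.

(** A nonzero class has a representative outside some maximal left ideal [M]. As [M] contains the
    radical it is a union of classes, so its image is still maximal and misses the class. *)
Lemma jacobson_quot_semisimple : semisimple (jacobson_quot R).
Proof.
pose p : {rmorphism R -> jacobson_quot R} := \pi_(jacobson_quot R)%qT.
have pP x y : p x = p y -> x - y \in @jacobson R by move/jquot_eqP.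
move=> s; have [r <-] : exists r, p r = s by elim/quotW: s => r; exists r.
move=> pr0; have [M maxM rM] : exists2 M, maximal_left_ideal M & r \notin M.
  apply/exists_inP; apply: contraR pr0; rewrite negb_exists_in => /forall_inP rJ.
  rewrite -(rmorph0 p); apply/eqP/jquot_eqP/jacobsonP => M maxM.
  by rewrite subr0; have := rJ M maxM; rewrite negbK.
have [M0 M1 Mlin] := maximal_left_idealW maxM.
have MJ x y : y \in M -> p x = p y -> x \in M.
  move=> yM /pP/jacobsonP/(_ M maxM) xyM.
  by have := Mlin 1 _ _ xyM yM; rewrite mul1r subrK.
have imM x : (p x \in [set p m | m in M]) = (x \in M).
  by apply/imsetP/idP => [[m mM /MJ]|xM]; [apply | exists x].
have surj t : exists x, p x = t by elim/quotW: t => x; exists x.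
exists [set p m | m in M]; last by rewrite imM.
apply/maxsetP; split.
  apply/proper_left_idealP; split.
  - by rewrite -(rmorph0 p) imM.
  - by rewrite -(rmorph1 p) imM.
  - move=> a u v; have [a' <-] := surj a; have [u' <-] := surj u.
    have [v' <-] := surj v; rewrite -rmorphM -rmorphD !imM; exact: Mlin.
move=> I /proper_left_idealP[I0 I1 Ilin] /subsetP sMI.
have preI : [set x | p x \in I] = M.
  case/maxsetP: maxM => _; apply.
    apply/proper_left_idealP; split; rewrite ?inE ?rmorph0 ?rmorph1 //.
    by move=> a u v; rewrite !inE rmorphD rmorphM; exact: Ilin.
  by apply/subsetP=> x xM; rewrite inE sMI // imM.
apply/setP=> t; have [x <-] := surj t.
by rewrite imM -preI inE.
Qed.

End JacobsonQuotient.

Lemma semisimple_well_covered (S : finUnitRingType) :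
    semisimple S -> well_covered (@unitary_cayley S) ->
  (exists F : finFieldType,
     [\/ ring_isomorphic S F, ring_isomorphic S (F * F)%type
       | ring_isomorphic S 'M[F]_2])
  \/ (exists k : nat,
        (0 < k)%N /\ ring_isomorphic S {ffun 'I_k -> 'Z_2}).
Proof.
move=> ssS wcS; have [E orthE sumE] := complete_orthogonal_primitives ssS.
have E0 : (0 < #|E|)%N.
  rewrite card_gt0; apply/eqP => E0; move: sumE; rewrite E0 big_set0 => /eqP.
  by rewrite eq_sym oner_eq0.
have [E3|] := ltnP 2 #|E|.
  have [e1 [e2 [e3 [[e1E e2E e3E] [e12 e23 e31]]]]] := card_gt2P E3.
  right; exists #|E|; split=> //; apply: card2_ring_isomorphic => // e eE.
  rewrite (card_corner_const orthE sumE wcS eE e1E).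
  by apply: (triple_card2 orthE sumE wcS e1E e2E e3E); rewrite // eq_sym.
rewrite leq_eqVlt => /orP[/cards2P[e1 [e2 [e12 Ee]]]|E1]; left.
  have e1E : e1 \in E by rewrite Ee set21.
  have e2E : e2 \in E by rewrite Ee set22.
  have [prim orth] := orthE.
  have [||||F [] isoF] := @pair_ring_isomorphic S e1 e2 (prim _ e1E) (prim _ e2E).
  - exact: orth.
  - by rewrite orth // eq_sym.
  - by move: sumE; rewrite Ee big_setU1 ?inE // big_set1.
  - exact: (card_corner_const orthE sumE wcS).
  - by exists F; apply: Or32.
  - by exists F; apply: Or33.
have [F isoF] : exists F : finFieldType, ring_isomorphic S F.
  by apply: (card1_field orthE sumE); apply/eqP; rewrite eqn_leq E0 andbT.
by exists F; apply: Or31.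
Qed.

Theorem theorem3p5 (R : finUnitRingType) :
  well_covered (@unitary_cayley R) <->
  (exists F : finFieldType,
     [\/ ring_isomorphic (jacobson_quot R) F,
         ring_isomorphic (jacobson_quot R) (F * F)%type
       | ring_isomorphic (jacobson_quot R) 'M[F]_2])
  \/ (exists k : nat,
        (0 < k)%N /\
        ring_isomorphic (jacobson_quot R) {ffun 'I_k -> 'Z_2}).
Proof.
split=> [/jacobson_quot_well_covered|].
  exact: semisimple_well_covered (@jacobson_quot_semisimple R).
case=> [[F [] iso] | [k [_ iso]]];
  have [f [surj uf]] := jacobson_quot_iso_reflect_unit iso.
- exact: well_covered_field uf.
- exact: well_covered_field_pair surj uf.
- exact: well_covered_mx2 surj uf.
- exact: well_covered_Z2 uf.
Qed.
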